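(* Let $f:\mathbb{R}^d\to\mathbb{R}$ be $L$-Lipschitz for some $L>0$, let $\delta>0$, and let $f_\delta(\mathbf{x})=\mathbb{E}_{\mathbf{u}\sim\mathbb{P}}[f(\mathbf{x}+\delta\mathbf{u})]$, where $\mathbb{P}$ is the uniform distribution on the unit ball of $\mathbb{R}^d$ in the $\ell_2$-norm. Let $\partial_\delta f$ be the $\delta$-Goldstein subdifferential of $f$. Then $\nabla f_\delta(\mathbf{x})\in\partial_\delta f(\mathbf{x})$ for every $\mathbf{x}\in\mathbb{R}^d$.
   Context: $\|\cdot\|$ is the Euclidean norm, and $f$ is $L$-Lipschitz if $|f(\mathbf{x})-f(\mathbf{x}')|\le L\|\mathbf{x}-\mathbf{x}'\|$ for all $\mathbf{x},\mathbf{x}'\in\mathbb{R}^d$. $\mathbb{B}_\delta(\mathbf{x})$ denotes the (closed) Euclidean ball of radius $\delta$ centered at $\mathbf{x}$. For such $f$, the function $f_\delta$ is everywhere differentiable, so $\nabla f_\delta$ is well defined. Generalized (Clarke) directional derivative: $Df(\mathbf{x};\mathbf{v}):=\limsup_{\mathbf{y}\to\mathbf{x},\,t\downarrow 0}\frac{f(\mathbf{y}+t\mathbf{v})-f(\mathbf{y})}{t}$. Generalized (Clarke) gradient: $\partial f(\mathbf{x}):=\{\mathbf{g}\in\mathbb{R}^d:\mathbf{g}^\top\mathbf{v}\le Df(\mathbf{x};\mathbf{v})\ \forall\mathbf{v}\in\mathbb{R}^d\}$. The $\delta$-Goldstein subdifferential of $f$ at $\mathbf{x}$ is $\partial_\delta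 f(\mathbf{x}):=\mathrm{conv}\left(\bigcup_{\mathbf{y}\in\mathbb{B}_\delta(\mathbf{x})}\partial f(\mathbf{y})\right)$. *)

(* Defs.v *)
From HB Require Import structures.
From mathcomp Require Import all_boot all_order all_algebra.
From mathcomp Require Import all_classical all_reals all_analysis.
From mathcomp Require Import measurable_realfun.

Set Implicit Arguments.
Unset Strict Implicit.
Unset Printing Implicit Defensive.

Import Order.TTheory GRing.Theory Num.Theory.
Import numFieldNormedType.Exports.

Local Open Scope classical_set_scope.
Local Open Scope ring_scope.

(* The library norm of 'rV[R]_d is the sup norm: it provides the topology (and
   hence the notion of derivative), but the Euclidean norm must be defined. *)
Definition dotv (R : realType) (d : nat) (u v : 'rV[R]_d) : R :=
  (u *m v^T) 0 0.

Definition enorm (R : realType) (d : nat) (x : 'rV[R]_d) : R :=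
  Num.sqrt (\sum_(i < d) x 0 i ^+ 2).

Definition eball (R : realType) (d : nat) (x : 'rV[R]_d) (r : R) :
  set 'rV[R]_d := [set y | enorm (y - x) <= r].

Definition elipschitz (R : realType) (d : nat) (L : R) (f : 'rV[R]_d -> R) :=
  forall x y, `|f x - f y| <= L * enorm (x - y).

Section measurable_rV.
Context (R : realType) (d : nat).

Let coord (i : 'I_d) (x : 'rV[R]_d) : measurableTypeR R := x 0 i.

Let rV_set0 : g_sigma_preimage coord set0.
Proof. exact: sigma_algebra0. Qed.

Let rV_setC A : g_sigma_preimage coord A -> g_sigma_preimage coord (~` A).
Proof. exact: sigma_algebraC. Qed.

Let rV_bigcup (F : _^nat) : (forall i, g_sigma_preimage coord (F i)) ->
  g_sigma_preimage coord (\bigcup_i F i).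
Proof. exact: sigma_algebra_bigcup. Qed.

(* The product sigma-algebra, generated by the d coordinates; it is also the
   Borel sigma-algebra of 'rV[R]_d. *)
HB.instance Definition _ := @isMeasurable.Build default_measure_display
  'rV[R]_d (g_sigma_preimage coord) rV_set0 rV_setC rV_bigcup.

Lemma measurable_coord (i : 'I_d) :
  measurable_fun setT (fun x : 'rV[R]_d => x 0 i : measurableTypeR R).
Proof.
move=> _ Y mY; rewrite setTI; apply: sub_sigma_algebra => /=.
rewrite -bigcup_seq/=; exists i => /=; first by rewrite mem_index_enum.
by exists Y => //; rewrite setTI.
Qed.

Lemma measurable_fun_rVP d1 (T : measurableType d1) (f : T -> 'rV[R]_d) :
  (forall i, measurable_fun setT (fun t => f t 0 i : measurableTypeR R)) ->
  measurable_fun setT f.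
Proof.
move=> mf _ Y mY; rewrite setTI.
pose G := image_set_system setT f measurable.
suff : G Y by rewrite /G /image_set_system /= setTI.
move: Y mY; apply: smallest_sub.
  by apply: sigma_algebra_image; exact: sigma_algebra_measurable.
rewrite -bigcup_seq/= => Y [i _] [B mB <-].
rewrite /G /image_set_system /= !setTI -comp_preimage.
by have := mf i measurableT B mB; rewrite setTI.
Qed.

End measurable_rV.

(* Lebesgue measure on 'rV[R]_d is the d-fold product of the Lebesgue measure
   on R: prepending one coordinate amounts to one more product. *)
Section lebesgue_cons.
Context (R : realType) (d : nat).

Definition rV_cons (p : measurableTypeR R * 'rV[R]_d) : 'rV[R]_d.+1 :=
  row_mx (p.1 : R)%:M p.2.

Definition rV_uncons (x : 'rV[R]_d.+1) : measurableTypeR R * 'rV[R]_d :=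
  (x 0 0, \row_j x 0 (lift 0 j)).

Lemma rV_consK : cancel rV_cons rV_uncons.
Proof.
move=> [a y]; rewrite /rV_cons /rV_uncons /=; congr pair.
  rewrite (_ : 0 = lshift d (0 : 'I_1)); last exact/val_inj.
  by rewrite (row_mxEl (a : R)%:M) mxE eqxx mulr1n.
apply/rowP => j; rewrite mxE (_ : lift 0 j = rshift 1 j); last exact/val_inj.
by rewrite (row_mxEr (a : R)%:M).
Qed.

Lemma measurable_rV_cons : measurable_fun setT rV_cons.
Proof.
apply: measurable_fun_rVP => i; case: (@split_ordP 1 d i) => j ->.
- rewrite (_ : (fun _ => _) = fst)//; apply/funext => p.
  by rewrite /rV_cons (row_mxEl (p.1 : R)%:M) ord1 mxE eqxx mulr1n.
- rewrite (_ : (fun _ => _) = (fun x : 'rV[R]_d => x 0 j) \o snd).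
    by apply: measurableT_comp => //; exact: measurable_coord.
  by apply/funext => p; rewrite /rV_cons (row_mxEr (p.1 : R)%:M).
Qed.

Lemma measurable_rV_uncons : measurable_fun setT rV_uncons.
Proof.
apply: measurable_fun_pair; first exact: measurable_coord.
apply: measurable_fun_rVP => j; rewrite (_ : (fun _ => _) =
    (fun x : 'rV[R]_d.+1 => x 0 (lift 0 j))); first exact: measurable_coord.
by apply/funext => x; rewrite mxE.
Qed.

Definition lebesgue_cons (m : {sigma_finite_measure set 'rV[R]_d -> \bar R}) :
    set 'rV[R]_d.+1 -> \bar R :=
  pushforward (@lebesgue_measure R \x m)%E rV_cons.

Context (m : {sigma_finite_measure set 'rV[R]_d -> \bar R}).

Let lebesgue_cons0 : lebesgue_cons m set0 = 0%E.
Proof. by rewrite /lebesgue_cons /pushforward preimage_set0 measure0. Qed.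

Let lebesgue_cons_ge0 A : (0 <= lebesgue_cons m A)%E.
Proof. by apply: measure_ge0; exact: measurable_rV_cons. Qed.

Let lebesgue_cons_sigma_additive : semi_sigma_additive (lebesgue_cons m).
Proof. by apply: measure_semi_sigma_additive; exact: measurable_rV_cons. Qed.

HB.instance Definition _ := isMeasure.Build _ _ _ (lebesgue_cons m)
  lebesgue_cons0 lebesgue_cons_ge0 lebesgue_cons_sigma_additive.

Let lebesgue_cons_sigma_finite : sigma_finite setT (lebesgue_cons m).
Proof.
have /sigma_finiteP[F [FT ndF Foo]] := sigma_finiteT (@lebesgue_measure R).
have /sigma_finiteP[G [GT ndG Goo]] := sigma_finiteT m.
exists (fun n => rV_uncons @^-1` (F n `*` G n)) => [|k].
  apply/esym/seteqP; split=> // x _.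
  have [[n _ Fn] [k _ Gk]] : (\bigcup_n F n) (rV_uncons x).1 /\
    (\bigcup_n G n) (rV_uncons x).2 by rewrite -FT -GT.
  exists (maxn n k) => //; split.
    by move: Fn; exact/subsetPset/ndF/leq_maxl.
  by move: Gk; exact/subsetPset/ndG/leq_maxr.
have [[? ?] [? ?]] := (Foo k, Goo k); split.
  rewrite -[X in measurable X]setTI.
  by apply: measurable_rV_uncons => //; exact: measurableX.
rewrite /lebesgue_cons /pushforward -comp_preimage.
rewrite (_ : _ \o _ = id); last by apply/funext => p /=; rewrite rV_consK.
by rewrite preimage_id product_measure1E// lte_mul_pinfty// ge0_fin_numE.
Qed.

HB.instance Definition _ := Measure_isSigmaFinite.Build _ _ _ (lebesgue_cons m)
  lebesgue_cons_sigma_finite.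

End lebesgue_cons.

Fixpoint lebesgue_rV (R : realType) (d : nat) :
    {sigma_finite_measure set 'rV[R]_d -> \bar R} :=
  match d with
  | 0 => \d_(0 : 'rV[R]_0)
  | d'.+1 => lebesgue_cons (lebesgue_rV R d')
  end.

Lemma measurable_eball (R : realType) (d : nat) (x : 'rV[R]_d) (r : R) :
  measurable (eball x r).
Proof.
have mn : measurable_fun setT (fun y : 'rV[R]_d => enorm (y - x)).
  apply: (@measurableT_comp _ _ _ _ _ _ (@Num.sqrt R)).
    by apply: continuous_measurable_fun; exact: sqrt_continuous.
  apply: measurable_sum => i; apply: measurable_funX.
  rewrite (_ : (fun _ => _) = (fun y : 'rV[R]_d => y 0 i - x 0 i)).
    by apply: measurable_funB => //; exact: measurable_coord.
  by apply/funext => y; rewrite !mxE.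
have := mn measurableT [set` `]-oo, r]] (measurable_itv _).
by rewrite setTI (_ : _ @^-1` _ = eball x r)//; apply/seteqP; split=> y /=;
  rewrite in_itv.
Qed.

(* The normalized restriction of the Lebesgue measure to the closed unit ball;
   the Dirac mass is a default value required by mnormalize, never used since
   the ball has positive finite measure. *)
Definition uniform_ball (R : realType) (d : nat) : probability 'rV[R]_d R :=
  mnormalize (mrestr (lebesgue_rV R d) (measurable_eball 0 1))
    \d_(0 : 'rV[R]_d).

Definition smoothing (R : realType) (d : nat) (f : 'rV[R]_d -> R) (delta : R)
    (x : 'rV[R]_d) : R :=
  fine 'E_(uniform_ball R d)[fun u => f (x + delta *: u)].

Definition gradient (R : realType) (d : nat) (g : 'rV[R]_d -> R)
    (x : 'rV[R]_d) : 'rV[R]_d :=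
  \row_(i < d) 'D_(delta_mx 0 i) g x.

Definition clarke_dderiv (R : realType) (d : nat) (f : 'rV[R]_d -> R)
    (x v : 'rV[R]_d) : \bar R :=
  limf_esup (fun p : 'rV[R]_d * R => ((f (p.1 + p.2 *: v) - f p.1) / p.2)%:E)
    (filter_prod (nbhs x) (0^'+)).

Definition clarke_gradient (R : realType) (d : nat) (f : 'rV[R]_d -> R)
    (x : 'rV[R]_d) : set 'rV[R]_d :=
  [set g | forall v, ((dotv g v)%:E <= clarke_dderiv f x v)%E].

Definition convex_hull (R : realType) (d : nat) (A : set 'rV[R]_d) :
    set 'rV[R]_d :=
  smallest (@convex_set R 'rV[R]_d) A.

Definition goldstein (R : realType) (d : nat) (f : 'rV[R]_d -> R) (delta : R)
    (x : 'rV[R]_d) : set 'rV[R]_d :=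
  convex_hull (\bigcup_(y in eball x delta) clarke_gradient f y).

(* Main.v *)
From HB Require Import structures.
Require Import Defs.
From mathcomp Require Import all_boot all_order all_algebra.
From mathcomp Require Import all_classical all_reals all_analysis.
From mathcomp Require Import measurable_realfun.
From mathcomp Require Import ring lra.
Set Implicit Arguments.
Unset Strict Implicit.
Unset Printing Implicit Defensive.
Import Order.TTheory GRing.Theory Num.Theory.
Import numFieldNormedType.Exports.
Local Open Scope classical_set_scope.
Local Open Scope ring_scope.

(** Why the theorem is true.

    The gradient of the smoothing is an average of local increments of f over
    the ball of radius delta around x, so it cannot exceed, in any direction v,
    the largest Clarke derivative Df(y; v) met on that ball.  Since Df(y; .) is
    the support function of the Clarke gradient at y, the gradient g of the
    smoothing satisfies the support inequalities of the Goldstein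
    subdifferential, and membership follows by separation once that convex hull
    is known to be compact.

    Differentiability.  Translating the ball by k changes the integral of a
    function bounded by M over it by at most M times the volume of a symmetric
    difference, which is O(|k|).  Applied to u |-> f(x + delta u + h) -
    f(x + delta u), itself bounded by L |h|, with k = h / delta, this bounds
    the second difference S(x + h) + S(x - h) - 2 S(x) of the smoothing S by
    C |h|^2 ([smoothing_second_difference]).  A Lipschitz function with such a
    bound is differentiable everywhere ([differentiable_of_second_difference]):
    the dyadic difference quotients 2^n (S(x + 2^-n h) - S(x)) converge, and
    their limit is additive in h because S is midpoint-affine up to second
    order.

    Membership.  The Clarke derivative is finite and sublinear in the direction
    ([clarke_sublinear]), so by the Hahn-Banach theorem some Clarke gradient
    attains it ([clarke_gradient_attains]).  Its graph is closed, hence the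
    union K of the Clarke gradients over the closed ball is compact, and by
    Caratheodory's theorem the convex hull of K is the set of combinations of
    d + 1 points of K, again compact ([convex_comb_compact]).  If g were
    outside, some v and M would satisfy <c, v> <= M < <g, v> on the hull
    ([strict_separation]).  Then Df(y; v) <= M on the closed ball, and
    compactness of the ball turns these pointwise bounds into a uniform one:
    for every M' > M and all small t > 0, f(z + t v) <= f(z) + t M' at every
    point z of the ball ([clarke_uniform_increment]).  Averaging this over z
    gives <g, v> <= M', which is absurd for M' < <g, v>. *)

(** * Differentiability from second differences *)

(** Additivity gives homogeneity for integers; a real factor N * r is an integer
    plus a remainder in [0, 1[, whose contribution is bounded independently of
    N and vanishes after division by N. *)
Lemma additive_bounded_scalable (R : realType) (V : normedModType R)
    (A : V -> R) (M : R) :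
  {morph A : h k / h + k} -> (forall h, `|A h| <= M * `|h|) ->
  forall r h, A (r *: h) = r * A h.
Proof.
move=> addA bndA.
have A0 : A 0 = 0.
  by have := addA 0 0; rewrite addr0 => /eqP;
    rewrite -subr_eq0 opprD addrA subrr sub0r oppr_eq0 => /eqP.
have AN h : A (- h) = - A h.
  by apply/eqP; rewrite -addr_eq0 -addA addNr A0.
have Anat n h : A (n%:R *: h) = n%:R * A h.
  elim: n => [|n IH]; first by rewrite scale0r A0 mul0r.
  by rewrite -addn1 natrD scalerDl scale1r addA IH mulrDl mul1r.
have Aint z h : A (z%:~R *: h) = z%:~R * A h.
  case: z => n; first exact: Anat.
  by rewrite NegzE mulrNz scaleNr AN Anat mulNr.
move=> r h; apply/eqP; rewrite -subr_eq0 -normr_le0.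
apply/ler_addgt0Pr => e e0; rewrite add0r.
pose B := 2 * (`|M| * `|h|).
have B0 : 0 <= B by rewrite !mulr_ge0.
pose N := (Num.truncn (B / e)).+1.
have N0 : 0 < N%:R :> R by rewrite ltr0n.
have BN : B <= N%:R * e.
  by rewrite -ler_pdivrMr//; apply/ltW/truncnS_gt.
pose th := N%:R * r - (Num.floor (N%:R * r))%:~R.
have th0 : 0 <= th by rewrite subr_ge0 floor_le.
have th1 : th <= 1 by rewrite lerBlDr addrC -intrD1; apply/ltW/floorD1_gt.
have E : N%:R * (A (r *: h) - r * A h) = A (th *: h) - th * A h.
  rewrite mulrBr -Anat scalerA mulrA
    -(subrK (Num.floor (N%:R * r))%:~R (N%:R * r)) -/th.
  by rewrite scalerDl addA Aint mulrDl opprD addrACA subrr addr0.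
rewrite -(ler_pM2l N0) -[X in X * _ <= _](gtr0_norm N0) -normrM E.
apply: le_trans BN; apply: le_trans (ler_normB _ _) _.
have Mh : `|A h| <= `|M| * `|h|.
  by apply: le_trans (bndA h) _; rewrite ler_wpM2r// ler_norm.
rewrite /B mulr_natl mulr2n lerD//.
  apply: le_trans (bndA _) _; rewrite normrZ (ger0_norm th0).
  apply: le_trans (_ : `|M| * (th * `|h|) <= _).
    by rewrite ler_wpM2r ?mulr_ge0// ler_norm.
  by rewrite ler_wpM2l// ler_piMl.
rewrite normrM (ger0_norm th0); apply: le_trans Mh.
by rewrite ler_piMl.
Qed.

(** The derivative at x is the limit A h of the dyadic quotients
    2^n (phi (x + 2^-n h) - phi x).  Consecutive quotients differ by a second
    difference, of size O(2^-n |h|^2), so that A h is within O(|h|^2) of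
    phi (x + h) - phi x; additivity of A compares the two midpoint estimates
    for the parallelogram x, x + h, x + k, x + h + k. *)
Lemma differentiable_of_second_difference (R : realType) (V : normedModType R)
    (phi : V -> R) (C M : R) :
  (forall y h, `|phi (y + h) + phi (y - h) - 2 * phi y| <= C * `|h| ^+ 2) ->
  (forall y z, `|phi y - phi z| <= M * `|y - z|) ->
  forall x, differentiable phi x.
Proof.
move=> second lip x.
pose psi h := phi (x + h) - phi x.
pose p n : R := 2^-1 ^+ n.
have p0 n : 0 < p n by rewrite exprn_gt0.
have pS n : p n.+1 = p n / 2 by rewrite /p exprSr.
have midpoint a b :
    `|phi a + phi b - 2 * phi (2^-1 *: (a + b))| <=
    C * `|2^-1 *: (a - b)| ^+ 2.
  have := second (2^-1 *: (a + b)) (2^-1 *: (a - b)).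
  have half (v : V) : 2^-1 *: (v + v) = v.
    by rewrite -mulr2n -[v *+ 2]scaler_nat scalerA mulVf// scale1r.
  have -> : 2^-1 *: (a + b) + 2^-1 *: (a - b) = a.
    by rewrite -scalerDr addrACA subrr addr0 half.
  have -> // : 2^-1 *: (a + b) - 2^-1 *: (a - b) = b.
  by rewrite -scalerBr opprB [b - a]addrC addrACA subrr add0r half.
pose u h n := (p n)^-1 * psi (p n *: h).
have C0 (h : V) : 0 <= C * `|h| ^+ 2 by have := second 0 h; apply: le_trans.
have uS h n : `|u h n.+1 - u h n| <= C * `|h| ^+ 2 / 4 * p n.
  have -> : u h n.+1 - u h n = - (p n)^-1 *
      (phi (x + p n *: h) + phi x - 2 * phi (2^-1 *: (x + p n *: h + x))).
    have -> : 2^-1 *: (x + p n *: h + x) = x + p n.+1 *: h.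
      rewrite addrAC -mulr2n scalerDr -[x *+ 2]scaler_nat !scalerA mulVf//.
      by rewrite scale1r pS mulrC.
    rewrite /u /psi pS; field.
    by rewrite gt_eqF// p0.
  rewrite normrM normrN normfV (gtr0_norm (p0 n)) ler_pdivrMl//.
  apply: le_trans (midpoint _ _) _.
  rewrite addrAC subrr add0r !normrZ gtr0_norm// gtr0_norm//.
  by rewrite le_eqVlt; apply/orP; left; apply/eqP; field.
have ub h n : `|u h n| <= M * `|h|.
  rewrite /u normrM normfV (gtr0_norm (p0 n)) ler_pdivrMl//.
  apply: le_trans (lip _ _) _.
  by rewrite addrAC subrr add0r normrZ (gtr0_norm (p0 n)) mulrCA.
have pcvg : p @ \oo --> 0.
  by rewrite /p; apply: cvg_expr; rewrite gtr0_norm// invf_lt1// ltr1n.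
pose K (h : V) := C * `|h| ^+ 2 / 2.
(* K h * 2^-n dominates the tail of the increments, hence up decreases, lo
   increases and both tend to A h, which they enclose from n = 0 on. *)
pose up h n := u h n + K h * p n.
pose lo h n := u h n - K h * p n.
have upS h : nonincreasing_seq (up h).
  apply/nonincreasing_seqP => n; have /ler_normlP[_] := uS h n.
  by rewrite /up /K pS; lra.
have loS h : nondecreasing_seq (lo h).
  apply/nondecreasing_seqP => n; have /ler_normlP[+ _] := uS h n.
  by rewrite /lo /K pS; lra.
have Kp h : (fun n => K h * p n) @ \oo --> 0.
  by rewrite -[0](mulr0 (K h)); apply: cvgM => //; exact: cvg_cst.
have ucvg h : cvgn (u h).
  have -> : u h = up h \- (fun n => K h * p n).
    by apply/funext => n; rewrite /up /= addrK.
  apply: is_cvgB; last by apply/cvg_ex; exists 0; exact: Kp.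
  apply: nonincreasing_is_cvgn; first exact: upS.
  exists (- (M * `|h|)) => _ [n _ <-].
  have /ler_normlP[+ _] := ub h n; rewrite /up.
  have : 0 <= K h * p n by rewrite /K mulr_ge0 ?divr_ge0//; exact: ltW.
  lra.
pose A h := limn (u h).
have uA h : u h @ \oo --> A h by exact: ucvg.
have AM h : `|A h| <= M * `|h|.
  have /cvg_norm nA := uA h.
  rewrite -(cvg_lim _ nA)//; apply: limr_le; first by apply/cvg_ex;
    exists `|A h|.
  by near=> n; exact: ub.
have Apsi h : `|psi h - A h| <= K h.
  have u0 : u h 0%N = psi h by rewrite /u /p expr0 invr1 mul1r scale1r.
  have upA : up h @ \oo --> A h by rewrite -[A h]addr0; apply: cvgD.
  have loA : lo h @ \oo --> A h by rewrite -[A h]subr0; apply: cvgB.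
  rewrite ler_distl; apply/andP; split; [rewrite lerBlDr|rewrite -lerBlDr].
    have -> : psi h + K h = up h 0%N by rewrite /up u0 /p expr0 mulr1.
    rewrite -(cvg_lim _ upA)//; apply: limr_le; first by apply/cvg_ex;
      exists (A h).
    by near=> n; exact: upS.
  have -> : psi h - K h = lo h 0%N by rewrite /lo u0 /p expr0 mulr1.
  rewrite -(cvg_lim _ loA)//; apply: limr_ge; first by apply/cvg_ex;
    exists (A h).
  by near=> n; exact: loS.
have addA : {morph A : h k / h + k}.
  move=> h k; apply/eqP; rewrite -subr_eq0 -normr_le0.
  pose D n := `|u (h + k) n - (u h n + u k n)|.
  have DA : D @ \oo --> `|A (h + k) - (A h + A k)|.
    by apply: cvg_norm; apply: cvgB => //; apply: cvgD.
  pose B := C * `|2^-1 *: (h + k)| ^+ 2 + C * `|2^-1 *: (h - k)| ^+ 2.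
  have Bp : (fun n => B * p n) @ \oo --> 0 by rewrite -[0](mulr0 B);
    apply: cvgM => //; exact: cvg_cst.
  rewrite -(cvg_lim _ DA)// -(cvg_lim _ Bp)//; apply: ler_lim.
  - by apply/cvg_ex; eexists; exact: DA.
  - by apply/cvg_ex; eexists; exact: Bp.
  near=> n; rewrite /D.
  have := midpoint (x + p n *: (h + k)) x.
  have := midpoint (x + p n *: h) (x + p n *: k).
  have -> : x + p n *: h + (x + p n *: k) = x + p n *: (h + k) + x.
    by rewrite addrACA -scalerDr addrAC.
  have -> : x + p n *: h - (x + p n *: k) = p n *: (h - k).
    by rewrite opprD addrACA subrr add0r -scalerBr.
  have -> : x + p n *: (h + k) - x = p n *: (h + k)
    by rewrite addrAC subrr add0r.
  set m := phi (2^-1 *: _).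
  rewrite ![2^-1 *: (p n *: _)]scalerA ![2^-1 * p n]mulrC -!scalerA
    !(normrZ (p n)) (gtr0_norm (p0 n)).
  rewrite !exprMn ![C * (p n ^+ 2 * _)]mulrCA.
  set b1 := C * _; set b2 := C * _ => m1 m2.
  have -> : u (h + k) n - (u h n + u k n) = (p n)^-1 *
     ((phi (x + p n *: (h + k)) + phi x - 2 * m) -
      (phi (x + p n *: h) + phi (x + p n *: k) - 2 * m)).
    rewrite /u /psi; move: (phi (x + p n *: (h + k))) (phi (x + p n *: h)) =>
      a b.
    by move: (phi (x + p n *: k)) (phi x) (p n)^-1 => *; ring.
  rewrite normrM normfV (gtr0_norm (p0 n)) ler_pdivrMl//.
  apply: le_trans (ler_normB _ _) _; apply: le_trans (lerD m2 m1) _.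
  by rewrite /B -/b1 -/b2 le_eqVlt; apply/orP; left; apply/eqP; ring.
have AZ := additive_bounded_scalable addA AM.
have linA : linear (A : V -> R^o) by move=> r h k; rewrite addA AZ.
pose A' : {linear V -> R^o} := HB.pack A (GRing.isLinear.Build _ _ _ _ A linA).
have contA : continuous A'.
  move=> y; apply/cvgrPdist_lt => e e0.
  have M1 : 0 < `|M| + 1 by rewrite ltr_wpDl.
  near=> z; rewrite -linearB; apply: le_lt_trans (AM _) _.
  apply: (@le_lt_trans _ _ ((`|M| + 1) * `|y - z|)).
    by rewrite ler_wpM2r//; have := ler_norm M; lra.
  rewrite -ltr_pdivlMl//; near: z; apply: (@cvgr_dist_lt _ _ _ (nbhs y) _ id);
    first exact: cvg_id.
  by rewrite mulr_gt0// invr_gt0.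
have expand : (phi : V -> R^o) \o shift x = cst (phi x) + A' +o_ 0 id.
  apply/eqaddoP => e e0; near=> h.
  have -> : (phi \o shift x - (cst (phi x) + A')) h = psi h - A h.
    change (phi (h + x) - (phi x + A h) = psi h - A h).
    by rewrite /psi [h + x]addrC opprD addrA.
  apply: le_trans (Apsi h) _; rewrite /K expr2.
  have : `|h| <= e / (`|C| / 2 + 1).
    near: h; apply: (@cvgr0_norm_le _ _ _ (nbhs (0 : V)) _ id);
      first exact: cvg_id.
    by rewrite divr_gt0// ltr_wpDl// divr_ge0.
  rewrite ler_pdivlMr; last by rewrite ltr_wpDl// divr_ge0.
  have := ler_norm C; have := normr_ge0 h; nra.
by apply/diff_locallyP; rewrite (diff_unique contA expand).
Unshelve. all: by end_near. Qed.

(** * Euclidean norm *)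

Lemma dotvE (R : realType) d (u v : 'rV[R]_d) :
  dotv u v = \sum_(i < d) u 0 i * v 0 i.
Proof. by rewrite /dotv mxE; apply: eq_bigr => i _; rewrite mxE. Qed.

Lemma dotvDl (R : realType) d (u v w : 'rV[R]_d) :
  dotv (u + v) w = dotv u w + dotv v w.
Proof. by rewrite /dotv mulmxDl mxE. Qed.

Lemma dotvC (R : realType) d (u v : 'rV[R]_d) : dotv u v = dotv v u.
Proof. by rewrite !dotvE; apply: eq_bigr => i _; rewrite mulrC. Qed.

Lemma dotvZl (R : realType) d a (u v : 'rV[R]_d) :
  dotv (a *: u) v = a * dotv u v.
Proof. by rewrite /dotv -scalemxAl mxE. Qed.

Lemma enorm_ge0 (R : realType) d (x : 'rV[R]_d) : 0 <= enorm x.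
Proof. exact: sqrtr_ge0. Qed.

Lemma enorm_sqr (R : realType) d (x : 'rV[R]_d) : enorm x ^+ 2 = dotv x x.
Proof.
rewrite sqr_sqrtr; last by apply: sumr_ge0 => i _; rewrite sqr_ge0.
by rewrite dotvE; apply: eq_bigr => i _; rewrite expr2.
Qed.

Lemma dotvDD (R : realType) d (u v : 'rV[R]_d) :
  dotv (u + v) (u + v) = dotv u u + 2 * dotv u v + dotv v v.
Proof. by rewrite dotvDl ![dotv _ (u + v)]dotvC !dotvDl (dotvC v u); ring. Qed.

Lemma enormZ (R : realType) d a (x : 'rV[R]_d) :
  enorm (a *: x) = `|a| * enorm x.
Proof.
apply/eqP; rewrite -(@eqrXn2 _ 2) ?mulr_ge0 ?enorm_ge0// exprMn !enorm_sqr.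
by rewrite dotvZl dotvC dotvZl real_normK ?num_real// expr2 mulrA.
Qed.

Lemma enorm0 (R : realType) d : enorm (0 : 'rV[R]_d) = 0.
Proof. by rewrite -(scale0r (0 : 'rV[R]_d)) enormZ normr0 mul0r. Qed.

Lemma enormN (R : realType) d (x : 'rV[R]_d) : enorm (- x) = enorm x.
Proof. by rewrite -scaleN1r enormZ normrN1 mul1r. Qed.

Lemma coord_le_enorm (R : realType) d (x : 'rV[R]_d) i : `|x 0 i| <= enorm x.
Proof.
rewrite -(@ler_pXn2r _ 2) ?nnegrE ?enorm_ge0// enorm_sqr dotvE (bigD1 i)//=.
by rewrite real_normK ?num_real// expr2 lerDl sumr_ge0// => j _;
  rewrite -expr2 sqr_ge0.
Qed.

Lemma enorm_eq0 (R : realType) d (x : 'rV[R]_d) : enorm x = 0 -> x = 0.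
Proof.
move=> x0; apply/rowP => i; apply/eqP; rewrite mxE -normr_le0 -x0.
exact: coord_le_enorm.
Qed.

(** Cauchy-Schwarz: expand the square of |v| u - |u| v. *)
Lemma dotv_le_enorm (R : realType) d (u v : 'rV[R]_d) :
  dotv u v <= enorm u * enorm v.
Proof.
have [u0|u0] := eqVneq (enorm u) 0.
  by rewrite (enorm_eq0 u0) enorm0 mul0r -(scale0r (0 : 'rV[R]_d)) dotvZl mul0r.
have [v0|v0] := eqVneq (enorm v) 0.
  by rewrite dotvC (enorm_eq0 v0) enorm0 mulr0 -(scale0r (0 : 'rV[R]_d)) dotvZl
    mul0r.
have up : 0 < enorm u by rewrite lt_neqAle eq_sym u0 enorm_ge0.
have vp : 0 < enorm v by rewrite lt_neqAle eq_sym v0 enorm_ge0.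
have := sqr_ge0 (enorm (enorm v *: u + (- enorm u) *: v)).
rewrite enorm_sqr dotvDD !dotvZl ![dotv _ (_ *: _)]dotvC !dotvZl -!enorm_sqr.
rewrite (dotvC v u) => H.
rewrite -(ler_pM2l (mulr_gt0 up vp)); nra.
Qed.

Lemma enorm_triangle (R : realType) d (u v : 'rV[R]_d) :
  enorm (u + v) <= enorm u + enorm v.
Proof.
rewrite -(@ler_pXn2r _ 2) ?nnegrE ?addr_ge0 ?enorm_ge0// enorm_sqr dotvDD
  -!enorm_sqr.
by have := dotv_le_enorm u v; nra.
Qed.

Lemma normv_le_enorm (R : realType) d (x : 'rV[R]_d) : `|x| <= enorm x.
Proof.
rewrite [leLHS]/Num.norm/= mx_normrE; apply/bigmax_leP; split;
  first exact: enorm_ge0.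
by move=> [i j] _ /=; rewrite ord1 coord_le_enorm.
Qed.

(** Comparison with the sup norm, which carries the topology and the
    derivative; the constant d is crude but any constant will do. *)
Lemma enorm_le_normv (R : realType) d (x : 'rV[R]_d) : enorm x <= d%:R * `|x|.
Proof.
have coord i : `|x 0 i| <= `|x|.
  by rewrite [leRHS]/Num.norm/= mx_normrE; apply/bigmax_geP; right;
    exists (0, i).
apply: (@le_trans _ _ (\sum_(i < d) `|x 0 i|)); last first.
  apply: le_trans (ler_sum _ (fun i _ => coord i)) _.
  by rewrite sumr_const card_ord mulr_natl.
rewrite -(@ler_pXn2r _ 2) ?nnegrE ?sumr_ge0 ?enorm_ge0// enorm_sqr dotvE expr2.
rewrite mulr_suml; apply: ler_sum => i _.
rewrite -[leLHS]ger0_norm -?expr2 ?sqr_ge0// normrX expr2 ler_wpM2l//.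
by rewrite (bigD1 i)//= lerDl sumr_ge0.
Qed.

Lemma enorm_continuous (R : realType) d : continuous (@enorm R d).
Proof.
move=> x; apply/(@cvgrPdist_le _ R^o _ (nbhs x)) => e e0; near=> y.
apply: (@le_trans _ _ (enorm (x - y))).
  rewrite ler_distl; apply/andP; split.
    rewrite lerBlDr -(enormN (x - y)) opprB.
    by apply: le_trans _ (enorm_triangle _ _); rewrite addrC subrK.
  by apply: le_trans _ (enorm_triangle _ _); rewrite addrC subrK.
apply: le_trans (enorm_le_normv _) _.
rewrite (@le_trans _ _ ((d%:R + 1) * `|x - y|)) ?ler_wpM2r ?lerDl//.
rewrite -ler_pdivlMl ?ltr_wpDl//.
near: y; apply: (@cvgr_dist_le _ _ _ (nbhs x) _ id); first exact: cvg_id.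
by rewrite mulr_gt0// invr_gt0 ltr_wpDl.
Unshelve. all: by end_near. Qed.

(** * Affine images of Lebesgue measure *)

Lemma lebesgue_measure_affine (R : realType) (a c : R)
    (A : set (measurableTypeR R)) : 0 < c -> measurable A ->
  lebesgue_measure ((fun t : measurableTypeR R => a + c * t : measurableTypeR R)
    @^-1` A)
    = ((c^-1)%:E * lebesgue_measure A)%E.
Proof.
move=> c0 mA.
pose phi := (fun t : measurableTypeR R => a + c * t : measurableTypeR R).
have mphi : measurable_fun setT phi.
  by apply: measurable_funD => //; apply: measurable_funM.
pose mu : {measure set (measurableTypeR R) -> \bar R} :=
  mscale (NngNum (ltW c0)) (pushforward (@lebesgue_measure R) phi).
have -> : lebesgue_measure A = mu mphi A.
  apply: lebesgue_measure_unique => // _ [[x y] _ <-].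
  rewrite /mu /= /mscale /= /pushforward.
  have -> : phi @^-1` `]x, y] = `](x - a) / c, (y - a) / c]%classic.
    apply/seteqP; split => t /=;
      rewrite !in_itv/= ltr_pdivrMr// ler_pdivlMr// ltrBlDl lerBrDl
        ![t * c]mulrC//.
  rewrite !lebesgue_measure_itv/= !lte_fin ltr_pM2r ?invr_gt0// ltrD2r.
  case: ifPn => // _; last by rewrite mule0.
  rewrite -!EFinD -EFinM; congr EFin; field; rewrite gt_eqF//.
change (lebesgue_measure (phi @^-1` A) =
  ((c^-1)%:E * (c%:E * lebesgue_measure (phi @^-1` A))))%E.
rewrite muleA -EFinM mulVf ?gt_eqF// mul1e//.
Qed.

Lemma ge0_integral_affine (R : realType) (a c : R)
    (F : measurableTypeR R -> \bar R) : 0 < c ->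
  measurable_fun setT F -> (forall t, 0 <= F t)%E ->
  (\int[lebesgue_measure]_t F (a + c * t)%R =
    (c^-1)%:E * \int[lebesgue_measure]_t F t)%E.
Proof.
move=> c0 mF F0.
pose phi := (fun t : measurableTypeR R => a + c * t : measurableTypeR R).
have mphi : measurable_fun setT phi.
  by apply: measurable_funD => //; apply: measurable_funM.
have ci0 : 0 <= c^-1 by rewrite invr_ge0 ltW.
have := ge0_integral_pushforward mphi (@lebesgue_measure R) measurableT mF
  (fun t _ => F0 t).
rewrite preimage_setT => <-.
rewrite (eq_measure_integral (mscale (NngNum ci0) (@lebesgue_measure R))) //=.
  by rewrite ge0_integral_mscale.
by move=> A mA _; rewrite /pushforward lebesgue_measure_affine.
Qed.

Lemma measurable_rV_affine (R : realType) d (a : 'rV[R]_d) (c : R) :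
  measurable_fun setT (fun y : 'rV[R]_d => a + c *: y).
Proof.
apply: measurable_fun_rVP => i.
rewrite (_ : (fun _ => _) = (fun y : 'rV[R]_d => a 0 i + c * y 0 i));
  last first.
  by apply/funext => y; rewrite !mxE.
by apply: measurable_funD => //; apply: measurable_funM => //;
  exact: measurable_coord.
Qed.

Lemma measurable_preimage d1 d2 (T1 : measurableType d1)
    (T2 : measurableType d2) (g : T1 -> T2) (A : set T2) :
  measurable_fun setT g -> measurable A -> measurable (g @^-1` A).
Proof. by move=> mg mA; rewrite -[X in measurable X]setTI; exact: mg. Qed.

Lemma lebesgue_rVS (R : realType) d (A : set 'rV[R]_d.+1) :
  (lebesgue_rV R d.+1 A =
    \int[lebesgue_measure]_t lebesgue_rV R d
      (xsection (@rV_cons R d @^-1` A) t))%E.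
Proof. by []. Qed.

Lemma rV_cons_head (R : realType) d (p : measurableTypeR R * 'rV[R]_d) :
  rV_cons p 0 (lshift d (0 : 'I_1)) = p.1.
Proof. by rewrite /rV_cons (row_mxEl (_ : R)%:M) mxE eqxx mulr1n. Qed.

Lemma rV_cons_tail (R : realType) d (p : measurableTypeR R * 'rV[R]_d) j :
  rV_cons p 0 (rshift 1 j) = p.2 0 j.
Proof. by rewrite /rV_cons (row_mxEr (_ : R)%:M). Qed.

(** Affine maps with a scalar linear part act coordinatewise, so they commute
    with the decomposition of a vector into its head and its tail. *)
Lemma rV_cons_affine (R : realType) d (a : 'rV[R]_d.+1) (c : R) p :
  a + c *: rV_cons p =
  rV_cons (((rV_uncons a).1 + c * p.1 : measurableTypeR R),
           (rV_uncons a).2 + c *: p.2).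
Proof.
apply/rowP => i; case: (@split_ordP 1 d i) => j ->;
  rewrite [LHS]mxE [X in _ + X]mxE.
- rewrite ord1 !rV_cons_head /=; congr (a 0 _ + _); exact/val_inj.
- rewrite !rV_cons_tail /= [RHS]mxE; congr (_ + _); last by rewrite [RHS]mxE.
  rewrite [RHS]mxE; congr (a 0 _); exact/val_inj.
Qed.

(** Induction on the dimension: the slices of a preimage are preimages of the
    slices, and the remaining integral over the first coordinate is an affine
    change of variable on the line.  Taking c = 1 gives invariance under
    translations, a = 0 the behaviour under dilations. *)
Lemma lebesgue_rV_affine (R : realType) d (a : 'rV[R]_d) (c : R) A :
  0 < c -> measurable A ->
  lebesgue_rV R d ((fun y => a + c *: y) @^-1` A) =
    ((c^-1 ^+ d)%:E * lebesgue_rV R d A)%E.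
Proof.
move=> c0; elim: d a A => [|d IH] a A mA.
  rewrite expr0 mul1e; congr (lebesgue_rV R 0 _).
  apply/seteqP; split => y /=; suff -> : a + c *: y = y by [];
    by apply/rowP => -[].
rewrite !lebesgue_rVS.
set S := rV_cons (d := d) @^-1` A.
have mS : measurable S by apply: measurable_preimage => //;
  exact: measurable_rV_cons.
pose a0 := (rV_uncons a).1; pose a' := (rV_uncons a).2.
transitivity (\int[lebesgue_measure]_t
   ((c^-1 ^+ d)%:E * lebesgue_rV R d (xsection S ((a0 : R) + c * t)%R)))%E.
  apply: eq_integral => t _; rewrite -(IH a'); last exact: measurable_xsection.
  congr (lebesgue_rV R d _); apply/seteqP; split => y /=;
    by rewrite /xsection /= !inE /S /= rV_cons_affine.
have mF : measurable_fun setT (fun t => lebesgue_rV R d (xsection S t)).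
  exact: measurable_fun_xsection.
rewrite ge0_integralZl//.
- rewrite (@ge0_integral_affine R a0 c
  (fun t => lebesgue_rV R d (xsection S t)))//.
  by rewrite muleA -EFinM exprSr.
- apply: (measurableT_comp mF).
  by apply: measurable_funD => //; apply: measurable_funM.
- by rewrite lee_fin exprn_ge0// invr_ge0 ltW.
Qed.

Definition cube (R : realType) d (a b : R) : set 'rV[R]_d :=
  [set x | forall i, a <= x 0 i <= b].

Lemma measurable_cube (R : realType) d (a b : R) :
  measurable (cube (d := d) a b).
Proof.
rewrite (_ : cube _ _ = \bigcap_(i : 'I_d) [set x | a <= x 0 i <= b]);
  last first.
  by apply/seteqP; split => x /= H i; [move=> _|]; exact: H.
apply: fin_bigcap_measurable => // i _.
have := @measurable_preimage _ _ _ _ _ `[a, b]%classic (@measurable_coord R d i)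
  (measurable_itv _).
by congr (measurable _); apply/seteqP; split => x /=; rewrite in_itv.
Qed.

Lemma lebesgue_rV_cube (R : realType) d (a b : R) : a <= b ->
  lebesgue_rV R d (cube a b) = ((b - a) ^+ d)%:E.
Proof.
move=> ab; elim: d => [|d IH].
  by rewrite expr0 /= diracE mem_set// => -[].
rewrite /= /lebesgue_cons /pushforward.
have -> : rV_cons (d := d) @^-1` cube a b = `[a, b]%classic `*` cube a b.
  apply/seteqP; split => -[t y] /=.
    move=> H; split => [|i].
      have := H 0; rewrite (_ : 0 = lshift d (0 : 'I_1)); last exact/val_inj.
      by rewrite rV_cons_head in_itv.
    by have := H (rshift 1 i); rewrite rV_cons_tail.
  move=> [+ H] i; rewrite in_itv/= => tab.
  case: (@split_ordP 1 d i) => j ->.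
    by rewrite ord1 rV_cons_head.
  by rewrite rV_cons_tail.
rewrite product_measure1E//; last exact: measurable_cube.
rewrite IH.
transitivity (lebesgue_measure `[a, b]%classic * ((b - a) ^+ d)%:E)%E => //.
rewrite lebesgue_measure_itv/= lte_fin exprS EFinM.
congr (_ * _)%E; case: ltgtP ab => // -> _; by rewrite subrr.
Qed.

Lemma lebesgue_rV_eball (R : realType) d (x : 'rV[R]_d) (r : R) : 0 < r ->
  lebesgue_rV R d (eball x r) = ((r ^+ d)%:E * lebesgue_rV R d (eball 0 1))%E.
Proof.
move=> r0; have ri0 : 0 < r^-1 by rewrite invr_gt0.
rewrite -[X in (X ^+ d)%:E](invrK r) -(lebesgue_rV_affine (- (r^-1 *: x)) ri0);
  last exact: measurable_eball.
congr (lebesgue_rV R d _); apply/seteqP; split => y;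
  rewrite /eball /= subr0 [- (_ *: _) + _]addrC -scalerBr;
  by rewrite enormZ gtr0_norm// mulrC ler_pdivrMr// mul1r.
Qed.

(** The ball lies between two cubes.  Both bounds matter: otherwise the
    normalization defining [uniform_ball] would fall back on its default
    measure. *)
Lemma lebesgue_rV_unit_ball (R : realType) d :
  (0 < lebesgue_rV R d (eball 0 1) < +oo)%E.
Proof.
apply/andP; split.
  have dp : 0 < (d%:R + 1 : R) by rewrite ltr_wpDl.
  apply: (@lt_le_trans _ _ (lebesgue_rV R d (cube 0 (d%:R + 1)^-1))).
    by rewrite lebesgue_rV_cube ?invr_ge0 ?ltW// subr0 lte_fin exprn_gt0//
      invr_gt0.
  apply: le_measure; rewrite ?inE;
    [exact: measurable_cube|exact: measurable_eball|].
  move=> y H; rewrite /eball /= subr0; apply: le_trans (enorm_le_normv _) _.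
  apply: (@le_trans _ _ (d%:R * (d%:R + 1)^-1)).
    rewrite ler_wpM2l// [leLHS]/Num.norm/= mx_normrE; apply/bigmax_leP; split.
      by rewrite invr_ge0 ltW.
    by move=> [i j] _ /=; rewrite ord1; case/andP: (H j) => ? ?;
      rewrite ger0_norm.
  by rewrite ler_pdivrMr// mul1r lerDl.
apply: (@le_lt_trans _ _ (lebesgue_rV R d (cube (-1) 1))).
  apply: le_measure; rewrite ?inE;
    [exact: measurable_eball|exact: measurable_cube|].
  move=> y; rewrite /eball /= subr0 => y1 i; rewrite -ler_norml.
  exact: le_trans (coord_le_enorm _ _) y1.
by rewrite lebesgue_rV_cube ?ltry//; lra.
Qed.

(** * Averages over the unit ball *)

Lemma rational_point_near (R : realType) d (x : 'rV[R]_d) (e : R) : 0 < e ->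
  exists q : 'rV[rat]_d, enorm (x - map_mx ratr q) < e.
Proof.
move=> e0; pose r := e / (d%:R + 1).
have dp : 0 < (d%:R + 1 : R) by rewrite ltr_wpDl.
have r0 : 0 < r by rewrite divr_gt0.
have /choice[q qP] : forall i,
    exists q : rat, ratr q \in `](x 0 i - r), (x 0 i)[.
  by move=> i; have [q qi] := @rat_in_itvoo R (x 0 i - r) (x 0 i) ltac:(lra);
    exists q.
exists (\row_i q i); apply: le_lt_trans (enorm_le_normv _) _.
apply: (@le_lt_trans _ _ (d%:R * r));
  last by rewrite /r mulrA ltr_pdivrMr// mulrC ltr_pM2l// ltrDl.
rewrite ler_wpM2l// [leLHS]/Num.norm/= mx_normrE; apply/bigmax_leP; split;
  first exact: ltW.
move=> [i j] _ /=; rewrite ord1 !mxE; have := qP j;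
  rewrite in_itv/= => /andP[q1 q2].
by rewrite ler_norml; apply/andP; split; lra.
Qed.

Lemma measurable_enormB (R : realType) d (x : 'rV[R]_d) :
  measurable_fun setT (fun y : 'rV[R]_d => enorm (y - x)).
Proof.
apply: (@measurableT_comp _ _ _ _ _ _ (@Num.sqrt R)).
  by apply: continuous_measurable_fun; exact: sqrt_continuous.
apply: measurable_sum => i; apply: measurable_funX.
rewrite (_ : (fun _ => _) = (fun y : 'rV[R]_d => y 0 i - x 0 i)).
  by apply: measurable_funB => //; exact: measurable_coord.
by apply/funext => y; rewrite !mxE.
Qed.

(** A Lipschitz function is the infimum of its cones f q + L |x - q| over the
    rational points q, so that each sublevel set is a countable union of
    sublevel sets of cones. *)
Lemma elipschitz_measurable (R : realType) d (f : 'rV[R]_d -> R) (L : R) :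
  0 < L -> elipschitz L f -> measurable_fun setT f.
Proof.
move=> L0 fL.
apply: (measurability _ (RGenInftyO.measurableE R)) => // _ [_ [a ->] <-].
rewrite setTI.
have -> : f @^-1` `]-oo, a[ = \bigcup_(q : 'rV[rat]_d)
    [set x : 'rV[R]_d | f (map_mx ratr q) + L * enorm (x - map_mx ratr q) < a].
  apply/seteqP; split => x /=; rewrite in_itv/=.
    move=> fa; have [|q qx] := @rational_point_near R d x ((a - f x) / (2 * L)).
      by rewrite divr_gt0 ?mulr_gt0// subr_gt0.
    exists q => //=; have /ler_normlP[+ _] := fL x (map_mx ratr q).
    by move: qx; rewrite ltr_pdivlMr ?mulr_gt0//; lra.
  move=> [q _ /=]; have /ler_normlP[_] := fL x (map_mx ratr q); lra.
apply: countable_bigcupT_measurable => [|q]; first exact: countableP.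
have mq : measurable_fun setT
    (fun x : 'rV[R]_d => f (map_mx ratr q) + L * enorm (x - map_mx ratr q)).
  by apply: measurable_funD => //; apply: measurable_funM => //;
    exact: measurable_enormB.
have := measurable_preimage mq (measurable_itv `]-oo, a[).
by congr (measurable _); apply/seteqP; split => x /=; rewrite in_itv.
Qed.

(** The arithmetic behind [ball_mean_shift]: c is the integral over the common
    part of two balls, a and b those over the two differences, of measure p. *)
Lemma scaled_difference_bound (R : realFieldType) (a b c M v p t : R) :
  0 <= M -> 0 < v -> `|a| <= M * p -> `|b| <= M * p -> p <= t * v ->
  `|v^-1 * (a + c) - v^-1 * (b + c)| <= 2 * M * t.
Proof.
move=> M0 v0 aM bM pt.
rewrite -mulrBr opprD addrACA subrr addr0 normrM gtr0_norm ?invr_gt0//.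
rewrite ler_pdivrMl//; apply: le_trans (ler_normB _ _) _.
have := ler_wpM2l M0 pt; lra.
Qed.

Section ball_mean.
Context (R : realType) (d : nat).
Local Notation m := (lebesgue_rV R d).
Local Notation B := (eball (0 : 'rV[R]_d) 1).
Local Notation V := (fine (m B)).

Let mB : measurable B. Proof. exact: measurable_eball. Qed.

Lemma unit_ball_volume_gt0 : 0 < V.
Proof.
have /andP[V0 Voo] := lebesgue_rV_unit_ball R d.
by rewrite fine_gt0// V0 Voo.
Qed.

Lemma unit_ball_volumeE : (m B = V%:E)%E.
Proof.
have /andP[V0 Voo] := lebesgue_rV_unit_ball R d.
by rewrite fineK// ge0_fin_numE// ltW.
Qed.

Lemma uniform_ballE A : uniform_ball R d A = ((V^-1)%:E * m (A `&` B))%E.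
Proof.
have /andP[V0 Voo] := lebesgue_rV_unit_ball R d.
rewrite /uniform_ball /= /mnormalize /= /mrestr setTI gt_eqF//= lt_eqF//=.
by rewrite muleC.
Qed.

Definition ball_mean (g : 'rV[R]_d -> R) : R := V^-1 * \int[m]_(u in B) g u.

Lemma ge0_expectation_ball (G : 'rV[R]_d -> \bar R) : measurable_fun setT G ->
  (forall u, 0 <= G u)%E ->
  (\int[uniform_ball R d]_u G u = (V^-1)%:E * \int[m]_(u in B) G u)%E.
Proof.
move=> mG G0.
have Vi0 : 0 <= V^-1 by rewrite invr_ge0 ltW// unit_ball_volume_gt0.
rewrite (@ge0_negligible_integral _ _ _ _ setT (~` B))//; last 2 first.
- exact: measurableC.
- by rewrite [LHS]uniform_ballE setICl measure0 mule0.
rewrite setTD setCK (eq_measure_integral (mscale (NngNum Vi0) m)) /=.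
  rewrite ge0_integral_mscale//; exact: measurable_funTS.
by move=> A mA AB; rewrite uniform_ballE (setIidl AB).
Qed.

Lemma bounded_on_ball_integrable (g : 'rV[R]_d -> R) (M : R)
    (D : set 'rV[R]_d) :
  measurable_fun setT g -> measurable D -> (m D < +oo)%E ->
  (forall u, D u -> `|g u| <= M) -> m.-integrable D (EFin \o g).
Proof.
move=> mg mD Doo gM; apply: measurable_bounded_integrable => //.
  exact: measurable_funTS.
exists M; split; first exact: num_real.
by move=> N MN u /= Bu; apply: le_trans (ltW MN); exact: gM.
Qed.

(** The ball has full measure, hence a bound on the ball suffices for the
    expectation to be an ordinary finite integral. *)
Lemma expectation_ball_mean (g : 'rV[R]_d -> R) (M : R) :
  measurable_fun setT g -> (forall u, B u -> `|g u| <= M) ->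
  fine 'E_(uniform_ball R d)[g] = ball_mean g.
Proof.
move=> mg gM; rewrite expectation.unlock /ball_mean /Rintegral.
have ig : m.-integrable B (EFin \o g).
  by apply: (bounded_on_ball_integrable mg mB _ gM);
    case/andP: (lebesgue_rV_unit_ball R d).
have mEg : measurable_fun setT (EFin \o g) by exact/measurable_EFinP.
rewrite -![fun w => (g w)%:E]/(EFin \o g) [in RHS]integralE.
have Ep := ge0_expectation_ball (measurable_funepos mEg)
  (fun u => funepos_ge0 _ u).
have En := ge0_expectation_ball (measurable_funeneg mEg)
  (fun u => funeneg_ge0 _ u).
transitivity (fine ((V^-1)%:E * \int[m]_(u in B) ((EFin \o g)^\+ u) -
  (V^-1)%:E * \int[m]_(u in B) ((EFin \o g)^\- u))%E).
    by rewrite [in LHS]integralE; congr (fine (_ - _)%E); [exact: Ep|exact: En].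
have fp := integrable_fin_num mB (integrable_funepos mB ig).
have fn := integrable_fin_num mB (integrable_funeneg mB ig).
rewrite -(fineK fp) -(fineK fn) -!EFinM -!EFinB /=.
by rewrite mulrBr.
Qed.

Lemma elipschitz_ball_integrable (g : 'rV[R]_d -> R) (K r : R)
    (D : set 'rV[R]_d) :
  0 < K -> elipschitz K g -> measurable D -> D `<=` eball 0 r ->
  m.-integrable D (EFin \o g).
Proof.
move=> K0 gK mD Dr.
pose s := `|r| + 1.
have s0 : 0 < s by rewrite ltr_wpDl.
have Ds : D `<=` eball 0 s.
  by move=> u /Dr; rewrite /eball /= => H; apply: le_trans H _;
    have := ler_norm r; rewrite /s; lra.
apply: (@bounded_on_ball_integrable _ (`|g 0| + K * s)) => //.
- exact: elipschitz_measurable K0 gK.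
- apply: (@le_lt_trans _ _ (m (eball 0 s))).
    by apply: le_measure; rewrite ?inE//; exact: measurable_eball.
  by rewrite lebesgue_rV_eball// unit_ball_volumeE -EFinM ltry.
- move=> u /Ds; rewrite /eball /= => us.
  rewrite -(subrK (g 0) (g u)) addrC; apply: le_trans (ler_normD _ _) _;
    rewrite lerD2l.
  by apply: le_trans (gK _ _) _; rewrite ler_pM2l.
Qed.

Lemma eball0_subset (r s : R) : r <= s -> eball (0 : 'rV[R]_d) r `<=` eball 0 s.
Proof. by move=> rs u; rewrite /eball /= => /le_trans; apply. Qed.

Lemma ball_mean_leD (g1 g2 : 'rV[R]_d -> R) (K c : R) :
  0 < K -> elipschitz K g1 -> elipschitz K g2 ->
  (forall u, B u -> g1 u <= g2 u + c) -> ball_mean g1 <= ball_mean g2 + c.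
Proof.
move=> K0 g1K g2K g12.
have i1 := elipschitz_ball_integrable K0 g1K mB (eball0_subset (lexx 1)).
have i2 := elipschitz_ball_integrable K0 g2K mB (eball0_subset (lexx 1)).
have ic : m.-integrable B (EFin \o cst c).
  apply: (@bounded_on_ball_integrable _ `|c|) => //.
  by rewrite unit_ball_volumeE ltry.
have V0 := unit_ball_volume_gt0.
have -> : ball_mean g2 + c = V^-1 * (\int[m]_(u in B) (g2 u + c)).
  by rewrite RintegralD// Rintegral_cst// mulrDr mulrCA mulVf ?mulr1// gt_eqF.
rewrite /ball_mean ler_pM2l ?invr_gt0//; apply: le_Rintegral => //.
have := integrableD mB i2 ic.
by apply: eq_integrable => // u _.
Qed.

Lemma Rintegral_translation (g : 'rV[R]_d -> R) (K : R) (k : 'rV[R]_d) :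
  0 < K -> elipschitz K g ->
  \int[m]_(u in B) g (u - k) = \int[m]_(u in eball (- k) 1) g u.
Proof.
move=> K0 gK; congr fine.
pose tau (w : 'rV[R]_d) : 'rV[R]_d := k + 1 *: w.
have mtau : measurable_fun setT tau by exact: measurable_rV_affine.
have tauB : tau @^-1` B = eball (- k) 1.
  by apply/seteqP; split => w; rewrite /eball /tau /= scale1r subr0 opprK addrC.
pose F := fun u => (g (u - k))%:E.
have tauF : F \o tau = EFin \o g.
  by apply/funext => w; rewrite /F /tau /= scale1r addrAC subrr add0r.
have hK : elipschitz K (fun u => g (u - k)).
  by move=> x y; apply: le_trans (gK _ _) _; rewrite opprB addrA subrK.
transitivity (\int[pushforward m tau]_(u in B) F u)%E.
  apply: eq_measure_integral => A mA _.
  by have := lebesgue_rV_affine k ltr01 mA; rewrite invr1 expr1n mul1e => E;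
    exact: esym E.
rewrite integral_pushforward//.
- by rewrite tauB; apply: eq_integral => u _;
  rewrite -[LHS]/((F \o tau) u) tauF.
- by apply/measurable_EFinP; exact: elipschitz_measurable K0 hK.
- rewrite tauB tauF.
  apply: (elipschitz_ball_integrable (r := 1 + enorm k) K0 gK).
    exact: measurable_eball.
  move=> u; rewrite /eball /= subr0 opprK => uk.
  rewrite -(addrK k u); apply: le_trans (enorm_triangle _ _) _.
  by rewrite enormN lerD2r.
Qed.

Lemma Rintegral_bound (g : 'rV[R]_d -> R) (K M r : R) (D : set 'rV[R]_d) :
  0 < K -> elipschitz K g -> measurable D -> D `<=` eball 0 r ->
  (forall u, `|g u| <= M) -> `|\int[m]_(u in D) g u| <= M * fine (m D).
Proof.
move=> K0 gK mD Dr gM.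
have ig := elipschitz_ball_integrable K0 gK mD Dr.
apply: le_trans (le_normr_Rintegral mD ig) _.
rewrite -Rintegral_cst//; apply: le_Rintegral => //.
  exact: integrable_norm.
apply: (elipschitz_ball_integrable (g := fun=> M) K0 _ mD Dr).
by move=> x y; rewrite subrr normr0 mulr_ge0 ?enorm_ge0// ltW.
Qed.

(** Shifting g amounts to integrating it over a shifted ball.  The common part
    cancels, and the two differences have the same volume p since both balls
    have volume V; as the union lies in the ball of radius 1 + |k|, scaling
    gives V + p <= (1 + |k|)^d V. *)
Lemma ball_mean_shift (g : 'rV[R]_d -> R) (K M : R) (k : 'rV[R]_d) :
  0 < K -> elipschitz K g -> (forall u, `|g u| <= M) ->
  `|ball_mean g - ball_mean (fun u => g (u - k))| <=
    2 * M * ((1 + enorm k) ^+ d - 1).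
Proof.
move=> K0 gK gM.
have V0 := unit_ball_volume_gt0.
have M0 : 0 <= M := le_trans (normr_ge0 _) (gM 0).
pose B' := eball (- k) 1.
have mB' : measurable B' by exact: measurable_eball.
pose r := 1 + enorm k.
have r0 : 0 < r by rewrite ltr_pwDl// enorm_ge0.
have BB : B `<=` eball 0 r by apply: eball0_subset; rewrite lerDl enorm_ge0.
have B'B : B' `<=` eball 0 r.
  move=> u; rewrite /B' /eball /= subr0 opprK => uk.
  rewrite -(addrK k u); apply: le_trans (enorm_triangle _ _) _.
  by rewrite enormN lerD2r.
have mB'V : m B' = V%:E.
  have := lebesgue_rV_affine k ltr01 mB;
    rewrite invr1 expr1n mul1e unit_ball_volumeE => <-.
  congr (m _); apply/seteqP; split => u;
    rewrite /B' /eball /= scale1r subr0 opprK addrC//.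
have fin D : measurable D -> D `<=` eball 0 r -> m D = (fine (m D))%:E.
  move=> mD Dr; rewrite fineK// ge0_fin_numE//;
    apply: (@le_lt_trans _ _ (m (eball 0 r))).
    by apply: le_measure; rewrite ?inE//; exact: measurable_eball.
  by rewrite lebesgue_rV_eball// unit_ball_volumeE -EFinM ltry.
have mD1 : measurable (B `\` B') by exact: measurableD.
have mD2 : measurable (B' `\` B) by exact: measurableD.
have mI : measurable (B `&` B') by exact: measurableI.
have D1r : B `\` B' `<=` eball 0 r by move=> u [/BB].
have D2r : B' `\` B `<=` eball 0 r by move=> u [/B'B].
have Ir : B `&` B' `<=` eball 0 r by move=> u [/BB].
pose p := fine (m (B `\` B')); pose p' := fine (m (B' `\` B)).
have pp' : p = p'.
  have : (m B = m (B `\` B') + m (B `&` B'))%E by exact: measureDI.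
  have : (m B' = m (B' `\` B) + m (B `&` B'))%E by rewrite setIC;
    exact: measureDI.
  rewrite mB'V unit_ball_volumeE (fin _ mD1)// (fin _ mD2)// (fin _ mI)//
    -!EFinD.
  rewrite -/p -/p' => -[+] -[]; lra.
have pV : p <= (r ^+ d - 1) * V.
  have : (m (B' `|` (B `\` B')) <= m (eball 0 r))%E.
    apply: le_measure; rewrite ?inE;
      [exact: measurableU|exact: measurable_eball|].
    by move=> u [/B'B|/D1r].
  have -> : (m (B' `|` (B `\` B')) = m B' + m (B `\` B'))%E.
    by apply: measureU => //; rewrite setDE setICA setICr setI0.
  rewrite lebesgue_rV_eball// mB'V unit_ball_volumeE (fin _ mD1)// -EFinD -EFinM
    lee_fin -/p.
  lra.
have split1 : \int[m]_(u in B) g u = \int[m]_(u in B `\` B') g u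
  + \int[m]_(u in B `&` B') g u.
  rewrite -Rintegral_setU//; first by rewrite setUC setUIDK.
  - by rewrite setUC setUIDK; exact: (elipschitz_ball_integrable K0 gK mB BB).
  - by apply/disj_setPS => u [[_ ?] [_ ?]].
have split2 : \int[m]_(u in B') g u = \int[m]_(u in B' `\` B) g u
  + \int[m]_(u in B `&` B') g u.
  rewrite [B `&` B']setIC -Rintegral_setU//; first by rewrite setUC setUIDK.
  - by rewrite setIC.
  - by rewrite setUC setUIDK; exact: (elipschitz_ball_integrable K0 gK mB' B'B).
  - by apply/disj_setPS => u [[_ ?] [_ ?]].
have b1 := Rintegral_bound K0 gK mD1 D1r gM.
have b2 := Rintegral_bound K0 gK mD2 D2r gM.
rewrite /ball_mean (Rintegral_translation _ K0 gK) -/B' split1 split2.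
apply: (scaled_difference_bound _ M0 V0 (p := p)); [exact: b1| |exact: pV].
by rewrite pp'; exact: b2.
Qed.

End ball_mean.

Lemma ball_meanB (R : realType) d (g1 g2 : 'rV[R]_d -> R) (K : R) :
  0 < K -> elipschitz K g1 -> elipschitz K g2 ->
  ball_mean (fun u => g1 u - g2 u) = ball_mean g1 - ball_mean g2.
Proof.
move=> K0 g1K g2K; rewrite /ball_mean RintegralB ?mulrBr//.
- exact: measurable_eball.
- exact: (elipschitz_ball_integrable K0 g1K (measurable_eball _ _)
  (eball0_subset (lexx 1))).
- exact: (elipschitz_ball_integrable K0 g2K (measurable_eball _ _)
  (eball0_subset (lexx 1))).
Qed.

(** On [0, 1] the convex function (1 + s)^n lies below its chord. *)
Lemma bernoulli_upper (R : realFieldType) n (s : R) :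
  0 <= s <= 1 -> (1 + s) ^+ n - 1 <= 2 ^+ n * s.
Proof.
move=> /andP[s0 s1].
suff : (1 + s) ^+ n <= 1 + (2 ^+ n - 1) * s by lra.
elim: n => [|n IH]; first by rewrite !expr0; lra.
have p1 : 1 <= 2 ^+ n :> R by apply: exprn_ege1; lra.
rewrite !exprS; apply: le_trans (ler_wpM2l _ IH) _; first lra.
have : s * s <= s by rewrite ler_piMl.
have : 0 <= s * (2 ^+ n - 1) by rewrite mulr_ge0//; lra.
nra.
Qed.

(** * Smoothing a Lipschitz function *)

Section smoothing.
Context (R : realType) (d : nat) (f : 'rV[R]_d -> R) (L delta : R).
Hypotheses (L0 : 0 < L) (fL : elipschitz L f) (delta0 : 0 < delta).
Local Notation S := (smoothing f delta).

Let LD0 : 0 < L * delta. Proof. exact: mulr_gt0. Qed.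

Lemma rescaled_elipschitz x :
  elipschitz (L * delta) (fun u => f (x + delta *: u)).
Proof.
move=> u v; apply: le_trans (fL _ _) _.
by rewrite opprD addrACA subrr add0r -scalerBr enormZ gtr0_norm// mulrA.
Qed.

Lemma smoothing_ball_mean x : S x = ball_mean (fun u => f (x + delta *: u)).
Proof.
apply: (@expectation_ball_mean _ _ _ (`|f x| + L * delta)).
  exact: elipschitz_measurable LD0 (rescaled_elipschitz x).
move=> u; rewrite /eball /= subr0 => u1.
have := rescaled_elipschitz x u 0; rewrite scaler0 addr0 subr0 => H.
rewrite -(subrK (f x) (f _)) addrC; apply: le_trans (ler_normD _ _) _;
  rewrite lerD2l.
by apply: le_trans H _; rewrite ler_piMr// ltW.
Qed.

Lemma smoothing_leD y z c :
  (forall u, eball 0 1 u -> f (y + delta *: u) <= f (z + delta *: u) + c) ->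
  S y <= S z + c.
Proof.
move=> H; rewrite !smoothing_ball_mean.
exact: (ball_mean_leD LD0 (rescaled_elipschitz _) (rescaled_elipschitz _) H).
Qed.

Lemma smoothing_elipschitz : elipschitz L S.
Proof.
have H y z : S y <= S z + L * enorm (y - z).
  apply: smoothing_leD => u _; rewrite -lerBlDl.
  by have /ler_normlP[_] := fL (y + delta *: u) (z + delta *: u);
    rewrite opprD addrACA subrr addr0.
move=> y z; rewrite ler_distl; apply/andP; split; last exact: H.
by rewrite lerBlDr -opprB enormN; exact: H.
Qed.

(** With q u = f (x + h + delta u) - f (x + delta u) and k = h / delta, the
    second difference is the mean of q minus the mean of q (. - k).  When
    |k| > 1 the Lipschitz bound 2 L |h| is already quadratic in h. *)
Lemma smoothing_second_difference x h :
  `|S (x + h) + S (x - h) - 2 * S x| <= 2 * 2 ^+ d * L / delta * enorm h ^+ 2.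
Proof.
have -> : S (x + h) + S (x - h) - 2 * S x
  = (S (x + h) - S x) - (S x - S (x - h)).
  by ring.
pose k := delta^-1 *: h.
have dk : delta *: k = h by rewrite scalerA divff ?scale1r// gt_eqF.
have h0 := enorm_ge0 h; have k0 := enorm_ge0 k.
have Ek : enorm k = enorm h / delta
  by rewrite enormZ gtr0_norm ?invr_gt0// mulrC.
have -> : 2 * 2 ^+ d * L / delta * enorm h ^+ 2
  = 2 * (L * enorm h) * (2 ^+ d * enorm k).
  by rewrite Ek; ring.
have Lh0 : 0 <= L * enorm h by rewrite mulr_ge0// ltW.
have [k1|k1] := leP (enorm k) 1; last first.
  apply: (@le_trans _ _ (2 * (L * enorm h) * 1)); last first.
    apply: ler_wpM2l; first by rewrite mulr_ge0.
    apply: le_trans (ltW k1) _.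
    by rewrite ler_peMl// exprn_ege1//; lra.
  apply: le_trans (ler_normB _ _) _.
  have := smoothing_elipschitz (x + h) x;
    have := smoothing_elipschitz x (x - h).
  by rewrite opprB addrCA subrr addr0 [x + h]addrC addrK; lra.
pose q u := f ((x + h) + delta *: u) - f (x + delta *: u).
have qK : elipschitz (2 * (L * delta)) q.
  move=> u v; have /ler_normlP[a1 a2] := rescaled_elipschitz (x + h) u v.
  have /ler_normlP[b1 b2] := rescaled_elipschitz x u v.
  by rewrite ler_norml /q; apply/andP; split; lra.
have qM u : `|q u| <= L * enorm h.
  by apply: le_trans (fL _ _) _;
    rewrite opprD addrACA subrr addr0 addrAC subrr add0r.
have -> : S (x + h) - S x = ball_mean q.
  rewrite !smoothing_ball_mean -(ball_meanB LD0)//; exact: rescaled_elipschitz.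
have -> : S x - S (x - h) = ball_mean (fun u => q (u - k)).
  rewrite !smoothing_ball_mean -(ball_meanB LD0);
    try exact: rescaled_elipschitz.
  congr ball_mean; apply/funext => u; rewrite /q scalerBr dk.
  by rewrite addrACA subrr addr0 [x - h + _]addrAC -addrA.
apply: le_trans (ball_mean_shift k _ qK qM) _; first by rewrite mulr_gt0.
apply: ler_wpM2l; first by rewrite mulr_ge0.
by apply: bernoulli_upper; rewrite k0.
Qed.

Lemma smoothing_differentiable x : differentiable S x.
Proof.
apply: (@differentiable_of_second_difference _ _ _
  (2 * 2 ^+ d * L / delta * d%:R ^+ 2) (L * d%:R)) => [y h|y z].
  apply: le_trans (smoothing_second_difference y h) _.
  rewrite -[leRHS]mulrA; apply: ler_wpM2l.
    by rewrite divr_ge0 ?mulr_ge0 ?exprn_ge0// ltW.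
  rewrite -exprMn ler_pXn2r ?nnegrE ?mulr_ge0 ?enorm_ge0//.
  exact: enorm_le_normv.
apply: le_trans (smoothing_elipschitz y z) _.
by rewrite -mulrA ler_pM2l// enorm_le_normv.
Qed.

Lemma dotv_gradient x v : dotv (gradient S x) v = 'D_v S x.
Proof.
have dS := smoothing_differentiable x.
rewrite deriveE// [v in RHS]row_sum_delta linear_sum dotvE /=;
  apply: eq_bigr => i _.
by rewrite mxE deriveE// linearZ /= mulrC.
Qed.

Lemma gradient_dotv_le x v (M : R) (t0 : R) : 0 < t0 ->
  (forall t, 0 < t < t0 -> S (x + t *: v) <= S x + t * M) ->
  dotv (gradient S x) v <= M.
Proof.
move=> t00 SM; rewrite dotv_gradient.
have dS : derivable S x v by apply: diff_derivable;
  exact: smoothing_differentiable.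
have /cvg_dnbhs_at_right C :
    t^-1 *: (((S : 'rV[R]_d -> R^o) \o shift x) (t *: v) - S x) @[t --> 0^']
      --> 'D_v S x.
  exact: dS.
rewrite -(cvg_lim _ C)//; apply: limr_le; first by apply/cvg_ex;
  exists ('D_v S x).
near=> t.
have t0' : 0 < t by near: t; exact: nbhs_right_gt.
rewrite -[leLHS]/(t^-1 * (S (t *: v + x) - S x)) ler_pdivrMl// lerBlDl.
rewrite [t *: v + x]addrC; apply: SM; rewrite t0' /=.
by near: t; exact: nbhs_right_lt.
Unshelve. all: by end_near. Qed.

End smoothing.

(** * The Hahn-Banach theorem in finite dimension *)

Definition sublinear (R : realType) d (q : 'rV[R]_d -> R) :=
  (forall u v, q (u + v) <= q u + q v) /\
  (forall t u, 0 < t -> q (t *: u) = t * q u).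

Section hahn_banach.
Context (R : realType) (d : nat).
Implicit Types (q : 'rV[R]_d -> R) (u v w z : 'rV[R]_d).

Lemma sublinear0 q : sublinear q -> q 0 = 0.
Proof. by move=> [_ qZ]; have := qZ 2 0 ltac:(lra); rewrite scaler0; lra. Qed.

Lemma sublinear_ge q w : sublinear q -> - q (- w) <= q w.
Proof.
by move=> sq; have := sq.1 w (- w); rewrite subrr sublinear0//; lra.
Qed.

Definition straighten_values q z w : set R :=
  [set q (w + t *: z) - t * q z | t in [set t | 0 <= t]].

(** The largest sublinear function below q that is linear along the line of z
    with slope q z. *)
Definition straighten q z w : R := inf (straighten_values q z w).

Lemma straighten_lbound q z w : sublinear q ->
  lbound (straighten_values q z w) (- q (- w)).
Proof.
move=> sq _ [t /= t0 <-].
have [->|t1] := eqVneq t 0;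
  first by rewrite scale0r addr0 mul0r subr0 sublinear_ge.
have tp : 0 < t by rewrite lt_neqAle eq_sym t1.
have := sq.1 (w + t *: z) (- w); rewrite addrAC subrr add0r sq.2//; lra.
Qed.

Lemma straighten_has_inf q z w : sublinear q ->
  has_inf (straighten_values q z w).
Proof.
move=> sq; split; last by exists (- q (- w)); exact: straighten_lbound.
by exists (q (w + 0 *: z) - 0 * q z), 0 => /=.
Qed.

Lemma straighten_le q z w t : sublinear q -> 0 <= t ->
  straighten q z w <= q (w + t *: z) - t * q z.
Proof.
move=> sq t0; apply: ge_inf; last by exists t.
by have [] := straighten_has_inf z w sq.
Qed.

Lemma straighten_ge q z w c : sublinear q ->
  (forall t, 0 <= t -> c <= q (w + t *: z) - t * q z) -> c <= straighten q z w.
Proof.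
move=> sq H; apply: lb_le_inf; first by have [] := straighten_has_inf z w sq.
by move=> _ [t t0 <-]; exact: H.
Qed.

Lemma straighten_le_self q z w : sublinear q -> straighten q z w <= q w.
Proof.
by move=> sq; have := straighten_le z w sq (lexx 0);
  rewrite scale0r addr0 mul0r subr0.
Qed.

Lemma straightenN q z : sublinear q -> straighten q z (- z) <= - q z.
Proof.
move=> sq; have := straighten_le z (- z) sq ler01.
by rewrite scale1r addNr sublinear0// mul1r sub0r.
Qed.

Lemma straighten_sublinear q z : sublinear q -> sublinear (straighten q z).
Proof.
move=> sq.
have scale t u : 0 < t -> t * straighten q z u <= straighten q z (t *: u).
  move=> t0; apply: straighten_ge => // s s0.
  have st : 0 <= t^-1 * s by rewrite mulr_ge0// invr_ge0 ltW.
  have -> : t *: u + s *: z = t *: (u + (t^-1 * s) *: z).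
    by rewrite scalerDr scalerA mulrA divff ?mul1r// gt_eqF.
  have := straighten_le z u sq st; rewrite sq.2// -(ler_pM2l t0) mulrBr.
  by rewrite 2!mulrA divff ?mul1r// gt_eqF.
split=> [u v|t u t0].
  rewrite -lerBlDr; apply: straighten_ge => // t t0.
  rewrite lerBlDl -lerBlDr; apply: straighten_ge => // s s0.
  rewrite lerBlDr; have := straighten_le z (u + v) sq (addr_ge0 t0 s0).
  have := sq.1 (u + t *: z) (v + s *: z).
  by rewrite addrACA -scalerDl; lra.
apply/eqP; rewrite eq_le scale// andbT.
have ti0 : 0 < t^-1 by rewrite invr_gt0.
have := scale _ (t *: u) ti0.
by rewrite scalerA mulVf ?gt_eqF// scale1r ler_pdivrMl.
Qed.

(** Straightening along further vectors preserves linearity along the previous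
    ones: a smaller sublinear function keeps q z + q (- z) <= 0, the reverse
    inequality being subadditivity. *)
Lemma straighten_seq q (s : seq 'rV[R]_d) : sublinear q ->
  exists q', [/\ sublinear q', (forall w, q' w <= q w) &
    forall z, z \in s -> q' z + q' (- z) <= 0].
Proof.
elim: s q => [|z s IH] q sq; first by exists q.
have [q' [sq' q'le q's]] := IH _ (straighten_sublinear z sq).
exists q'; split => // [w|y].
  exact: le_trans (q'le w) (straighten_le_self _ _ sq).
rewrite inE => /predU1P[->|/q's//].
have := q'le z; have := q'le (- z); have := straighten_le_self z z sq.
by have := straightenN z sq; lra.
Qed.

(** Straighten q along v and then along the canonical basis: the result is
    sublinear and linear along each coordinate axis, hence linear. *)
Lemma hahn_banach q v : sublinear q ->
  exists g, dotv g v = q v /\ forall w, dotv g w <= q w.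
Proof.
move=> sq.
have sq1 := straighten_sublinear v sq.
have [q' [sq' q'le q's]] := straighten_seq
  [seq (delta_mx 0 i : 'rV[R]_d) | i <- enum 'I_d] sq1.
have qe i : q' (delta_mx 0 i) + q' (- delta_mx 0 i) <= 0.
  by apply: q's; apply: map_f; rewrite mem_enum.
pose g : 'rV[R]_d := \row_i q' (delta_mx 0 i).
have coordle i a : q' (a *: delta_mx 0 i) <= a * q' (delta_mx 0 i).
  have [a0|a0|->] := ltgtP a 0.
  - rewrite -(opprK a) scaleNr -scalerN sq'.2 ?oppr_gt0// mulNr.
    have := qe i; nra.
  - by rewrite sq'.2.
  - by rewrite scale0r sublinear0// mul0r.
have gle w : q' w <= dotv g w.
  rewrite [w in leLHS]row_sum_delta dotvE.
  apply: (big_rec2 (fun u r => q' u <= r)); first by rewrite sublinear0.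
  move=> i r u _ ur; apply: le_trans (sq'.1 _ _) (lerD _ ur).
  by rewrite mxE mulrC.
have gN w : dotv g (- w) = - dotv g w
  by rewrite -scaleN1r dotvC dotvZl mulN1r dotvC.
have gge w : dotv g w <= q' w.
  have := gle (- w); rewrite gN; have := sublinear_ge w sq'; lra.
have gq w : dotv g w <= q w.
  by apply: le_trans (gge w) _; apply: le_trans (q'le w) _;
    exact: straighten_le_self.
exists g; split => //; apply/eqP; rewrite eq_le gq/=.
have := q'le (- v); have := straightenN v sq; have := gge (- v); rewrite gN;
  lra.
Qed.

End hahn_banach.

(** * Caratheodory's theorem and compact convex hulls *)

Definition convex_comb (R : realType) d (K : set 'rV[R]_d) n : set 'rV[R]_d :=
  [set x | exists (a : 'I_n -> R) (p : 'I_n -> 'rV[R]_d),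
    [/\ forall i, 0 <= a i, \sum_i a i = 1, forall i, K (p i) &
        x = \sum_i a i *: p i]].

Section caratheodory.
Context (R : realType) (d : nat) (K : set 'rV[R]_d).

Lemma convex_comb_point n x : K x -> convex_comb K n.+1 x.
Proof.
move=> Kx; exists (fun i => (i == ord0)%:R), (fun=> x); split => //.
  by rewrite (bigD1 ord0)//= big1 ?addr0// => i /negPf ->.
by rewrite (bigD1 ord0)//= big1 ?addr0 ?scale1r// => i /negPf ->;
  rewrite scale0r.
Qed.

Lemma convex_comb1 : convex_comb K 1 `<=` K.
Proof.
move=> x [a [p [_ + Kp ->]]]; rewrite !big_ord1 => ->.
by rewrite scale1r.
Qed.

Lemma convex_comb_join n y z t : 0 <= t <= 1 -> convex_comb K n y -> K z ->
  convex_comb K n.+1 (t *: y + (1 - t) *: z).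
Proof.
move=> /andP[t0 t1] [a [p [a0 a1 Kp ->]]] Kz.
exists (fun i => if unlift ord0 i is Some j then t * a j else 1 - t),
  (fun i => if unlift ord0 i is Some j then p j else z).
split.
- by move=> i; case: unliftP => [j|] _; rewrite ?mulr_ge0// subr_ge0.
- rewrite big_ord_recl unlift_none.
  under eq_bigr do rewrite liftK.
  by rewrite -mulr_sumr a1 mulr1 subrK.
- by move=> i; case: unliftP.
- rewrite big_ord_recl unlift_none addrC; congr (_ + _).
  by rewrite scaler_sumr; apply: eq_bigr => j _; rewrite liftK scalerA.
Qed.

(** With [convex_comb_join], this describes combinations of n + 2 points as the
    segments from combinations of n + 1 points to K, which gives both
    compactness and inclusion in the convex hull by induction. *)
Lemma convex_comb_split n x : convex_comb K n.+2 x ->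
  exists t y z, [/\ 0 <= t <= 1, convex_comb K n.+1 y, K z &
    x = t *: y + (1 - t) *: z].
Proof.
move=> [a [p [a0 a1 Kp ->]]].
pose t := \sum_(i < n.+1) a (lift ord0 i).
have t0 : 0 <= t by apply: sumr_ge0.
have at1 : a ord0 + t = 1 by rewrite -a1 [RHS]big_ord_recl.
have [te|tn] := eqVneq t 0.
  exists 0, (p ord0), (p ord0); split => //; first by rewrite lexx ler01.
    exact: convex_comb_point.
  rewrite big_ord_recl -at1 te addr0 scale0r add0r subr0 big1 ?addr0// => i _.
  suff -> : a (lift ord0 i) = 0 by rewrite scale0r.
  by move/eqP: te; rewrite psumr_eq0// => /allP/(_ i (mem_index_enum _))/eqP.
exists t, (\sum_(i < n.+1) (a (lift ord0 i) / t) *: p (lift ord0 i)), (p ord0);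
  split => //.
- by rewrite t0 /= -at1 lerDr.
- exists (fun i => a (lift ord0 i) / t), (fun i => p (lift ord0 i));
  split => //.
    by move=> i; rewrite divr_ge0.
  by rewrite -mulr_suml divff.
- have -> : 1 - t = a ord0 by rewrite -at1 addrK.
  rewrite big_ord_recl addrC; congr (_ + _).
  rewrite scaler_sumr; apply: eq_bigr => i _.
  by rewrite scalerA mulrCA divff ?mulr1.
Qed.

Lemma convex_comb_segment n m x y t : 0 <= t <= 1 ->
  convex_comb K n x -> convex_comb K m y ->
  convex_comb K (n + m) (t *: x + (1 - t) *: y).
Proof.
move=> /andP[t0 t1] [a [p [a0 a1 Kp ->]]] [b [q [b0 b1 Kq ->]]].
exists (fun i : 'I_(n + m) => match fintype.split i with
                              | inl j => t * a j
                              | inr j => (1 - t) * b j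
                              end),
  (fun i : 'I_(n + m) => match fintype.split i with
                         | inl j => p j
                         | inr j => q j
                         end).
split.
- by move=> i; case: splitP => j _; rewrite mulr_ge0// subr_ge0.
- rewrite big_split_ord/=.
  under eq_bigr do rewrite (unsplitK (inl _)).
  under [X in _ + X]eq_bigr do rewrite (unsplitK (inr _)).
  by rewrite -!mulr_sumr a1 b1 !mulr1 addrC subrK.
- by move=> i; case: splitP.
- rewrite big_split_ord/= !scaler_sumr; congr (_ + _); apply: eq_bigr => i _.
    by rewrite (unsplitK (inl _)) scalerA.
  by rewrite (unsplitK (inr _)) scalerA.
Qed.

(** More than d + 1 points: the matrix whose rows are the points extended by a
    coordinate 1 has too few columns for its rows to be free. *)
Lemma affine_dependence n (p : 'I_n -> 'rV[R]_d) : (d.+1 < n)%N ->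
  exists c : 'I_n -> R, [/\ \sum_i c i *: p i = 0, \sum_i c i = 0 &
    exists i, 0 < c i].
Proof.
move=> dn.
pose M : 'M[R]_(n, d + 1) := row_mx (\matrix_i p i) (const_mx 1).
have /rowV0Pn[c /sub_kermxP cM cn0] : kermx M != 0.
  rewrite -mxrank_eq0 mxrank_ker subn_eq0 -ltnNge.
  by apply: leq_ltn_trans (rank_leq_col _) _; rewrite addn1.
have [c1 c2] : c *m \matrix_i p i = 0 /\ c *m const_mx 1 = 0 :> 'M[R]_(1, 1).
  by apply: eq_row_mx; rewrite -mul_mx_row row_mx0.
have s0 : \sum_i c 0 i = 0.
  have := congr1 (fun A : 'M[R]_(1, 1) => A 0 0) c2; rewrite !mxE => e;
    rewrite -[RHS]e.
  by apply: eq_bigr => i _; rewrite mxE mulr1.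
exists (fun i => c 0 i); split => //.
  rewrite -[RHS]c1 mulmx_sum_row; apply: eq_bigr => i _; congr (_ *: _).
  by apply/rowP => j; rewrite !mxE.
apply: contrapT => /forallNP H.
have cle i : 0 <= - c 0 i by rewrite oppr_ge0 leNgt; exact/negP/H.
case/eqP: cn0; apply/rowP => i; rewrite mxE.
have /eqP : \sum_i - c 0 i = 0 by rewrite sumrN s0 oppr0.
rewrite psumr_eq0// => /allP/(_ i (mem_index_enum _)).
by rewrite oppr_eq0 => /eqP.
Qed.

(** Subtract the multiple of an affine dependence that first cancels a
    weight, namely the smallest ratio a i / c i over the indices with
    0 < c i. *)
Lemma caratheodory_step n : (d.+1 <= n)%N ->
  convex_comb K n.+1 `<=` convex_comb K n.
Proof.
move=> dn x [a [p [a0 a1 Kp ->]]].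
have [c [cp c0 [i1 ci1]]] := affine_dependence p dn.
have [i0 ci0 i0min] := @arg_minP _ R _ i1 (fun i => 0 < c i)
  (fun i => a i / c i) ci1.
pose t := a i0 / c i0.
have t0 : 0 <= t by rewrite divr_ge0// ltW.
pose a' i := a i - t * c i.
have a'i0 : a' i0 = 0 by rewrite /a' /t divfK ?subrr// gt_eqF.
have a'0 i : 0 <= a' i.
  rewrite subr_ge0; have [ci|ci] := leP (c i) 0.
    by apply: le_trans (a0 i); rewrite mulr_ge0_le0.
  by rewrite -ler_pdivlMr//; exact: i0min.
exists (fun j => a' (lift i0 j)), (fun j => p (lift i0 j)); split => //.
- have : \sum_i a' i = 1 by rewrite sumrB -mulr_sumr c0 mulr0 subr0.
  by rewrite (bigD1_ord i0)//= a'i0 add0r.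
- have : \sum_i a' i *: p i = \sum_i a i *: p i.
    under eq_bigr do rewrite scalerBl -scalerA.
    by rewrite sumrB -scaler_sumr cp scaler0 subr0.
  by rewrite (bigD1_ord i0)//= a'i0 scale0r add0r.
Qed.

Lemma caratheodory n : convex_comb K (d.+1 + n) `<=` convex_comb K d.+1.
Proof.
elim: n => [|n IH]; first by rewrite addn0.
by rewrite addnS => x /caratheodory_step H; apply: IH; apply: H;
  rewrite leq_addr.
Qed.

Lemma convex_comb_convex x y t : 0 <= t <= 1 ->
  convex_comb K d.+1 x -> convex_comb K d.+1 y ->
  convex_comb K d.+1 (t *: x + (1 - t) *: y).
Proof.
by move=> t01 Cx Cy; apply: (@caratheodory d.+1); exact: convex_comb_segment.
Qed.

Lemma convex_comb_compact n : compact K -> compact (convex_comb K n.+1).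
Proof.
move=> cK; elim: n => [|n IH].
  rewrite (_ : convex_comb K 1 = K)//; apply/seteqP; split;
    first exact: convex_comb1.
  by move=> x; exact: convex_comb_point.
pose F (p : (R * 'rV[R]_d) * 'rV[R]_d) : 'rV[R]_d :=
  p.1.1 *: p.1.2 + (1 - p.1.1) *: p.2.
have -> : convex_comb K n.+2 = F @` ((`[0, 1] `*` convex_comb K n.+1) `*` K).
  apply/seteqP; split => x.
    move=> /convex_comb_split[t [y [z [t01 Cy Kz ->]]]].
    by exists ((t, y), z) => //=; split => //; split => //=; rewrite in_itv.
  move=> [[[t y] z] [[/= + Cy] Kz] <-]; rewrite in_itv/= => t01.
  exact: convex_comb_join.
apply: continuous_compact; last by do 2 apply: compact_setX => //;
  exact: segment_compact.
apply: continuous_subspaceT => p; rewrite /F.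
have c1 : (fun q : (R * 'rV[R]_d) * 'rV[R]_d => q.1.1) @ p --> p.1.1.
  by apply: (@cvg_comp _ _ _ fst fst _ (nbhs p.1));
    [exact: cvg_fst|exact: cvg_fst].
have c2 : (fun q : (R * 'rV[R]_d) * 'rV[R]_d => q.1.2) @ p --> p.1.2.
  by apply: (@cvg_comp _ _ _ fst snd _ (nbhs p.1));
    [exact: cvg_fst|exact: cvg_snd].
apply: cvgD; first exact: cvgZ.
apply: cvgZ; last exact: cvg_snd.
by apply: cvgB => //; exact: cvg_cst.
Qed.

Lemma convex_comb_hull n : convex_comb K n.+1 `<=` convex_hull K.
Proof.
move=> x Cx S [cS KS]; elim: n x Cx => [|n IH] x.
  by move=> /convex_comb1; exact: KS.
move=> /convex_comb_split[t [y [z [t01 /IH Sy /KS Sz ->]]]].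
have /andP[t0 t1] := t01.
pose k : {i01 R} := Itv01 t0 t1.
have := cS y z k (mem_set Sy) (mem_set Sz).
by rewrite inE.
Qed.

End caratheodory.

(** The separating direction is g - c with c the point of C closest to g:
    moving from c towards another point of C cannot decrease the distance. *)
Lemma strict_separation (R : realType) d (C : set 'rV[R]_d) g :
  compact C -> C !=set0 ->
  (forall x y t, 0 <= t <= 1 -> C x -> C y -> C (t *: x + (1 - t) *: y)) ->
  ~ C g -> exists v M, (forall c, C c -> dotv c v <= M) /\ M < dotv g v.
Proof.
move=> cC C0 convC Cg.
have [|c cC0 cmin] := EVT_min_rV (f := fun x => enorm (g - x)) C0 cC.
  apply: continuous_subspaceT => x.
  have gx : (fun y => g - y) @ nbhs x --> g - x.
    by apply: (@cvgB _ _ _ (nbhs x) _ (cst g) id);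
      [exact: cvg_cst|exact: cvg_id].
  exact: cvg_comp gx (@enorm_continuous R d (g - x)).
have {}cC0 : C c by rewrite inE in cC0.
pose v := g - c; exists v, (dotv c v).
have v0 : 0 < dotv v v.
  rewrite -enorm_sqr exprn_gt0// lt_neqAle enorm_ge0 andbT eq_sym.
  by apply/eqP => /enorm_eq0/eqP; rewrite subr_eq0 => /eqP E; apply: Cg;
    rewrite E.
have gE : dotv g v = dotv c v + dotv v v by rewrite -dotvDl [c + v]addrC subrK.
split; last by rewrite gE ltrDl.
move=> y Cy; pose w := y - c.
have yE : dotv y v = dotv c v + dotv w v by rewrite -dotvDl [c + w]addrC subrK.
rewrite yE gerDl; apply/ler_addgt0Pr => e e0; rewrite add0r.
have key t : 0 < t <= 1 -> 2 * dotv w v <= t * dotv w w.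
  move=> /andP[t0 t1].
  have /mem_set/cmin : C (t *: y + (1 - t) *: c) by apply: convC => //;
    rewrite t1 ltW.
  have -> : g - (t *: y + (1 - t) *: c) = v + (- t) *: w.
    by apply/rowP => i; rewrite !mxE; ring.
  rewrite -(@ler_pXn2r _ 2) ?nnegrE ?enorm_ge0// !enorm_sqr -/v dotvDD.
  rewrite dotvZl !(dotvC _ ((- t) *: w)) !dotvZl.
  move=> H; rewrite -(ler_pM2l t0); lra.
have ww : 0 <= dotv w w by rewrite -enorm_sqr sqr_ge0.
pose t := Num.min 1 (e / (dotv w w + 1)).
have w1 : 0 < dotv w w + 1 by lra.
have t01 : 0 < t <= 1 by rewrite /t lt_min ltr01 divr_gt0// ge_min lexx.
have te : t * (dotv w w + 1) <= e by rewrite -ler_pdivlMr// ge_min lexx orbT.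
have := key t t01; have /andP[] := t01; nra.
Qed.

(** * Clarke derivatives of a Lipschitz function *)

Section clarke.
Context (R : realType) (d : nat) (f : 'rV[R]_d -> R) (L : R).
Hypotheses (L0 : 0 < L) (fL : elipschitz L f).
Implicit Types (x y z u v w g : 'rV[R]_d) (r t : R).

Local Notation dq v := (fun p : 'rV[R]_d * R =>
  (f (p.1 + p.2 *: v) - f p.1) / p.2).
Local Notation near_dir x := (filter_prod (nbhs (x : 'rV[R]_d))
  (0^'+ : set_system R)).

Lemma clarke_lt x v r : (clarke_dderiv f x v < r%:E)%E ->
  \forall p \near near_dir x, dq v p < r.
Proof.
move=> /ereal_inf_lt[_ [A FA <-] Ar].
apply: filterS FA => p Ap; rewrite -lte_fin; apply: le_lt_trans Ar.
by apply: ereal_sup_ubound; exists p.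
Qed.

Lemma clarke_le x v r : (\forall p \near near_dir x, dq v p <= r) ->
  (clarke_dderiv f x v <= r%:E)%E.
Proof.
move=> FA; apply: (@le_trans _ _ (ereal_sup
  ((fun p : 'rV[R]_d * R => (dq v p)%:E) @` [set p | dq v p <= r]))).
  by apply: ereal_inf_lbound; exists [set p | dq v p <= r].
by apply: ge_ereal_sup => _ [p /= pr <-]; rewrite lee_fin.
Qed.

Lemma near_dir_pos x : \forall p \near near_dir x, 0 < p.2.
Proof.
exists (setT, [set t | 0 < t]) => //=; last by move=> [z t] [].
by split; [exact: filterT|exact: nbhs_right_gt].
Qed.

Lemma near_dirI x (P Q : set ('rV[R]_d * R)) :
  (\forall p \near near_dir x, P p) -> (\forall p \near near_dir x, Q p) ->
  \forall p \near near_dir x, P p /\ Q p.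
Proof. by move=> HP HQ; apply: (@filterI _ (near_dir x) _ P Q). Qed.

Lemma near_dirS x (P Q : set ('rV[R]_d * R)) :
  (forall p, 0 < p.2 -> P p -> Q p) ->
  (\forall p \near near_dir x, P p) -> \forall p \near near_dir x, Q p.
Proof.
move=> PQ HP; apply: filterS (near_dirI HP (near_dir_pos x)).
by move=> p [Pp p0]; exact: PQ.
Qed.

Lemma dq_bound p v : 0 < p.2 -> `|dq v p| <= L * enorm v.
Proof.
move=> p0; rewrite normrM normfV (gtr0_norm p0) ler_pdivrMr//.
apply: le_trans (fL _ _) _.
by rewrite addrAC subrr add0r enormZ (gtr0_norm p0) -mulrA [_ * enorm v]mulrC.
Qed.

(** The difference quotients are bounded by L |v|; for the lower bound the
    filter must also be proper. *)
Lemma clarke_fin x v : clarke_dderiv f x v \is a fin_num.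
Proof.
rewrite fin_numElt; apply/andP; split; last first.
  apply: (@le_lt_trans _ _ (L * enorm v)%:E); last exact: ltry.
  apply: clarke_le; apply: filterS (near_dir_pos x) => p p0.
  by have /ler_normlP[] := dq_bound v p0.
apply: (@lt_le_trans _ _ (- (L * enorm v))%:E); first exact: ltNyr.
rewrite leNgt; apply/negP => /clarke_lt H.
have [p [p1 p2]] := @filter_ex _ (near_dir x)
  _ _ (@filterI _ (near_dir x) _ _ _ H (near_dir_pos x)).
by have /ler_normlP[] := dq_bound v p2; lra.
Qed.

Definition clarke_real x v : R := fine (clarke_dderiv f x v).

Lemma clarke_realE x v : clarke_dderiv f x v = (clarke_real x v)%:E.
Proof. by rewrite fineK// clarke_fin. Qed.

Lemma clarke_real_lt x v r : clarke_real x v < r ->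
  \forall p \near near_dir x, dq v p < r.
Proof. by move=> H; apply: clarke_lt; rewrite clarke_realE lte_fin. Qed.

Lemma clarke_real_le x v r : (\forall p \near near_dir x, dq v p <= r) ->
  clarke_real x v <= r.
Proof. by move=> /clarke_le; rewrite clarke_realE lee_fin. Qed.

Lemma clarke_real_le_norm x v : clarke_real x v <= L * enorm v.
Proof.
apply: clarke_real_le; apply: filterS (near_dir_pos x) => p p0.
by have /ler_normlP[] := dq_bound v p0.
Qed.

(** Changes of base point and step size that are compatible with the limit
    defining the Clarke derivative; both halves of sublinearity rest on it. *)
Lemma near_dir_map x (h : 'rV[R]_d * R -> 'rV[R]_d) (k : R -> R)
    (A : set ('rV[R]_d * R)) :
  h @ near_dir x --> nbhs x ->
  k @ (0^'+ : set_system R) --> (0^'+ : set_system R) ->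
  (\forall p \near near_dir x, A p) ->
  \forall p \near near_dir x, A (h p, k p.2).
Proof.
move=> hx k0 [[U T] [xU T0] UT].
have [[U1 T1] /= [xU1 T10] hU] := hx U xU.
exists (U1, T1 `&` [set t | T (k t)]) => /=.
  by split=> //; apply: filterI => //; exact: k0.
move=> [z t] [/= Uz [Tt Tk]]; apply: (UT (h (z, t), k t)); split => //=.
exact: (hU (z, t)).
Qed.

(** Homogeneity rescales the step.  For subadditivity, the increment along
    t (u + v) from z is the increment along t u from z + t v, which still tends
    to x, followed by the increment along t v from z. *)
Lemma clarke_sublinear x : sublinear (clarke_real x).
Proof.
have cst2 : (fun p : 'rV[R]_d * R => p.2) @ near_dir x --> (0^'+ : set_system R)
  by exact: cvg_snd.
have cst2' : (fun p : 'rV[R]_d * R => p.2) @ near_dir x --> (0 : R).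
  by apply: cvg_trans cst2 _; exact: cvg_within.
have homog t u : 0 < t -> clarke_real x (t *: u) <= t * clarke_real x u.
  move=> t0; apply/ler_addgt0Pr => e e0.
  apply: clarke_real_le.
  have et : 0 < e / t by rewrite divr_gt0.
  have /clarke_real_lt H : clarke_real x u < clarke_real x u + e / t
    by rewrite ltrDl.
  have tcvg : (fun s => t * s) @ (0^'+ : set_system R)
    --> (0^'+ : set_system R).
    move=> A [e1 /= e10 eA]; exists (e1 / t) => /=; first by rewrite divr_gt0.
    move=> s /= se s0; apply: eA; last by rewrite mulr_gt0.
    rewrite /ball /= sub0r normrN normrM (gtr0_norm t0) mulrC -ltr_pdivlMr//.
    by move: se; rewrite /ball /= sub0r normrN.
  have fstc : fst @ near_dir x --> nbhs x by exact: cvg_fst.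
  have N := near_dir_map fstc tcvg H.
  apply: (near_dirS _ N) => p p0 /= Hp.
  have := ltW Hp; rewrite !ler_pdivrMr ?mulr_gt0// scalerA [p.2 * t]mulrC => K.
  by apply: le_trans K _; rewrite le_eqVlt; apply/orP; left; apply/eqP; field;
    rewrite gt_eqF.
split=> [u v|t u t0]; last first.
  apply/eqP; rewrite eq_le homog//=.
  have ti0 : 0 < t^-1 by rewrite invr_gt0.
  have := homog _ (t *: u) ti0.
  by rewrite scalerA mulVf ?gt_eqF// scale1r mulrC ler_pdivlMr// mulrC.
apply/ler_addgt0Pr => e e0; apply: clarke_real_le.
have e2 : 0 < e / 2 by rewrite divr_gt0.
have /clarke_real_lt Hu : clarke_real x u < clarke_real x u + e / 2
  by rewrite ltrDl.
have /clarke_real_lt Hv : clarke_real x v < clarke_real x v + e / 2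
  by rewrite ltrDl.
have C : (fun p : 'rV[R]_d * R => p.1 + p.2 *: v) @ near_dir x --> x.
  have : (fun p : 'rV[R]_d * R => p.1 + p.2 *: v) @ near_dir x --> x + 0 *: v.
    apply: cvgD; first exact: cvg_fst.
    by apply: cvgZ => //; exact: cvg_cst.
  by rewrite scale0r addr0.
have idcvg : id @ (0^'+ : set_system R) --> (0^'+ : set_system R)
  by exact: cvg_id.
have Hu' := near_dir_map C idcvg Hu.
have N := near_dirI Hu' Hv.
apply: (near_dirS _ N) => p p0 /= [{}Hu' {}Hv].
have -> : dq (u + v) p =
    (f (p.1 + p.2 *: v + p.2 *: u) - f (p.1 + p.2 *: v)) / p.2 + dq v p.
  rewrite -mulrDl; congr (_ / _).
  by rewrite addrA subrK scalerDr [_ *: u + _]addrC addrA.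
lra.
Qed.

Lemma clarke_gradient_attains x v :
  exists2 g, clarke_gradient f x g & dotv g v = clarke_real x v.
Proof.
have [g [gv gle]] := hahn_banach v (clarke_sublinear x).
by exists g => // w; rewrite clarke_realE lee_fin.
Qed.

Lemma clarke_gradient_le x g v : clarke_gradient f x g ->
  dotv g v <= clarke_real x v.
Proof. by move=> /(_ v); rewrite clarke_realE lee_fin. Qed.

Lemma clarke_gradient_bounded x g : clarke_gradient f x g -> enorm g <= L.
Proof.
move=> /(clarke_gradient_le g); have := clarke_real_le_norm x g.
rewrite -enorm_sqr; have [->|g0] := eqVneq (enorm g) 0; first by move=> _ _;
  exact: ltW.
have gp : 0 < enorm g by rewrite lt_neqAle eq_sym g0 enorm_ge0.
by move=> a b; rewrite -(ler_pM2r gp) -expr2; exact: le_trans b a.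
Qed.

Lemma dotv_continuous v : continuous (fun g : 'rV[R]_d => dotv g v).
Proof.
move=> g; rewrite (_ : (fun g => _) = fun g : 'rV[R]_d =>
  \sum_(i < d) g 0 i * v 0 i); last first.
  by apply/funext => h; rewrite dotvE.
apply: (@cvg_big _ _ _ _ _ _ _ (nbhs g)) => [|i _]; first exact: add_continuous.
apply: (@cvgM _ _ (nbhs g)); last exact: cvg_cst.
exact: coord_continuous.
Qed.

(** This is upper semicontinuity of the Clarke derivative: a strict bound on
    the quotients near x is also a bound near every z close to x. *)
Lemma clarke_graph_closed :
  closed [set p : 'rV[R]_d * 'rV[R]_d | clarke_gradient f p.1 p.2].
Proof.
move=> [x g] /= clxg v /=; rewrite clarke_realE lee_fin leNgt; apply/negP => lt.
pose r := (clarke_real x v + dotv g v) / 2.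
have xr : clarke_real x v < r by rewrite /r; lra.
have rg : r < dotv g v by rewrite /r; lra.
have [[U T] /= [Ux T0] UT] := clarke_real_lt xr.
have N1 : nbhs x [set z | clarke_real z v <= r].
  have := nbhs_interior Ux; apply: filterS => z Uz.
  apply: clarke_real_le; exists (U, T) => //= p pUT; apply: ltW; exact: UT.
have N2 : nbhs g [set h | r < dotv h v].
  have /cvgrPdist_lt := @dotv_continuous v g.
  have gr0 : 0 < dotv g v - r by lra.
  move=> /(_ _ gr0); apply: filterS => h /=; rewrite ltr_distlC; lra.
have /clxg : nbhs (x, g) ([set z | clarke_real z v <= r]
  `*` [set h | r < dotv h v]).
  by exists ([set z | clarke_real z v <= r], [set h | r < dotv h v]).
move=> [[z h] /= [/(clarke_gradient_le v) zh [zr hr]]]; lra.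
Qed.

Lemma eball_compact x r : compact (eball x r).
Proof.
apply: bounded_closed_compact.
  exists (`|x| + r); split; first exact: num_real.
  move=> M xM y yr; apply: le_trans (ltW xM).
  rewrite -(subrK x y) addrC; apply: le_trans (ler_normD _ _) _; rewrite lerD2l.
  exact: le_trans (normv_le_enorm _) yr.
rewrite (_ : eball x r = (fun y => enorm (y - x)) @^-1` [set t | t <= r])//.
apply: preimage_closed => [y _|]; last exact: closed_le.
have yx : (fun y => y - x) @ nbhs y --> y - x.
  by apply: (@cvgB _ _ _ (nbhs y) _ id (cst x)); [exact: cvg_id|exact: cvg_cst].
exact: cvg_comp yx (@enorm_continuous R d (y - x)).
Qed.

Lemma clarke_union_compact x r :
  compact (\bigcup_(y in eball x r) clarke_gradient f y).
Proof.
have -> : \bigcup_(y in eball x r) clarke_gradient f y =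
    snd @` ((eball x r `*` eball 0 L) `&`
      [set p : 'rV[R]_d * 'rV[R]_d | clarke_gradient f p.1 p.2]).
  apply/seteqP; split => g.
    move=> [y yx yg]; exists (y, g) => //; split => //; split => //=.
    by rewrite /eball /= subr0; exact: clarke_gradient_bounded yg.
  by move=> [[y h] [[/= yx _] yh] <-]; exists y.
apply: continuous_compact.
  by apply: continuous_subspaceT => p; exact: cvg_snd.
apply: compact_closedI; last exact: clarke_graph_closed.
by apply: compact_setX; exact: eball_compact.
Qed.

(** The definition of the Clarke derivative bounds the quotients in a
    neighbourhood of each y for small t; finitely many of these neighbourhoods
    cover the ball. *)
Lemma clarke_uniform_increment x r v M :
  (forall y, eball x r y -> clarke_real y v < M) ->
  exists2 t0, 0 < t0 & forall t z, 0 < t < t0 -> eball x r z ->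
    f (z + t *: v) <= f z + t * M.
Proof.
move=> H; have /compact_near_coveringP cov := @eball_compact x r.
have [e /= e0 He] : \forall t \near (0^'+ : set_system R),
    eball x r `<=` (fun z => dq v (z, t) < M).
  apply: (cov R (0^'+ : set_system R) (fun t z => dq v (z, t) < M)) => y.
  by move=> /H/clarke_real_lt[[U T] [UT1 UT2] UT]; exists (U, T).
exists e => // t z /andP[t0 te] zx.
have := He t _ t0 z zx; rewrite /ball /= sub0r normrN gtr0_norm// => /(_ te).
by move=> /ltW; rewrite ler_pdivrMr// lerBlDl [M * t]mulrC.
Qed.

End clarke.

(** * Gradients of the smoothing *)

Theorem theorem3p1 (R : realType) (d : nat) (f : 'rV[R]_d -> R) (L delta : R)
    (L_gt0 : 0 < L) (f_lip : elipschitz L f) (delta_gt0 : 0 < delta)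
    (x : 'rV[R]_d) :
  differentiable (smoothing f delta) x /\
  goldstein f delta x (gradient (smoothing f delta) x).
Proof.
split; first exact: smoothing_differentiable L_gt0 f_lip delta_gt0 x.
set g := gradient _ _.
pose K := \bigcup_(y in eball x delta) clarke_gradient f y.
have K_compact : compact K by exact: clarke_union_compact L_gt0 f_lip x delta.
apply: (@convex_comb_hull _ _ K d).
apply: contrapT => gC.
have attain y v : eball x delta y ->
    exists2 p, K p & dotv p v = clarke_real f y v.
  move=> yx; have [p yp pv] := clarke_gradient_attains f_lip y v.
  by exists p => //; exists y.
have xx : eball x delta x by rewrite /eball /= subrr enorm0 ltW.
have [|v [M [CM Mg]]] := strict_separation
  (convex_comb_compact (n := d) K_compact) _ (@convex_comb_convex _ _ K) gC.
  by have [p Kp _] := attain x 0 xx; exists p; exact: convex_comb_point.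
pose M' := (M + dotv g v) / 2.
have [|t0 t00 incr] := @clarke_uniform_increment _ _ f L f_lip x delta v M'.
  move=> y /(attain y v)[p Kp <-].
  have := CM p (convex_comb_point _ Kp); rewrite /M'; lra.
have : dotv g v <= M'.
  apply: (gradient_dotv_le L_gt0 f_lip delta_gt0 t00) => t t0'.
  apply: (smoothing_leD L_gt0 f_lip delta_gt0) => u u1.
  rewrite addrAC; apply: incr => //.
  rewrite /eball /= addrAC subrr add0r enormZ gtr0_norm//; apply: ler_piMr;
    first exact: ltW.
  by move: u1; rewrite /eball /= subr0.
rewrite /M'; lra.
Qed.
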